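(* Let $f:\mathbb{R}^n\to\mathbb{R}$ be twice continuously differentiable, let $\{x_k\}$ be generated by the MINRES-based linesearch method described in the context, and let $\mathcal A:=\{x^*:\liminf_{k\to\infty}\|x_k-x^*\|=0\}$ be the set of accumulation points of $\{x_k\}$. Suppose that: (1) there is $M>0$ such that $\|B_k\|\le M$ for all $k\in\mathbb{N}$; (2) $\theta_k=\min\{\mathsf B,b_k\|g_k\|^{\beta}\}$ for all $k$, with $\mathsf B,\beta>0$ and $b_k\ge\bar b>0$; (3) $\zeta_k=\min\{\mathsf Z,z_k\|g_k\|^{\zeta}\}$ for all $k$, with $\mathsf Z>0$, $\zeta\in(0,1]$, $z_k\ge\bar z>0$; (4) $\sum_{k=1}^\infty a_k^{-1/\alpha}<\infty$, $\sum_{k=1}^\infty z_k^{-1/\zeta}<\infty$, and $\sum_{k=1}^\infty b_k^{-1/\beta}<\infty$. Suppose that $x^*\in\mathcal A$ is an accumulation point of $\{x_k\}$ at which $f$ satisfies the Kurdyka–Łojasiewicz property. Then either the method stops after finitely many iterations at a stationary point, or the whole sequence $\{x_k\}$ converges to $x^*$ with $\lim_{k\to\infty}\|g_k\|=0$.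
   Context: Notation: $\|\cdot\|$ is the Euclidean norm for vectors and the spectral norm for matrices; $\mathbb S_n$ is the set of symmetric real $n\times n$ matrices; $g_k:=\nabla f(x_k)$. Kurdyka–Łojasiewicz (KL) property: for $\eta>0$, $\mathfrak L_\eta$ is the class of continuous concave functions $\varrho:[0,\eta)\to[0,\infty)$ with $\varrho\in C^1((0,\eta))$, $\varrho(0)=0$ and $\varrho'(t)>0$ for all $t\in(0,\eta)$. The function $f$ has the KL property at $\bar x$ if there exist $\eta\in(0,\infty]$, a neighborhood $V$ of $\bar x$ and $\varrho\in\mathfrak L_\eta$ such that $\varrho'(f(x)-f(\bar x))\,\|\nabla f(x)\|\ge1$ for all $x\in V$ with $0<f(x)-f(\bar x)<\eta$. MINRES routine (exact arithmetic). Given $A\in\mathbb S_n$, $b\in\mathbb{R}^n\setminus\{0\}$ and a tolerance $\theta\ge 0$, let $\mathcal K_t(A,b)=\mathrm{span}\{b,Ab,\dots,A^{t-1}b\}$, $p_0=0$, $p_t=\mathrm{argmin}_{p\in\mathcal K_t(A,b)}\|b-Ap\|$ and $r_t=b-Ap_t$. $\mathrm{MINRES}(A,b,\theta)$ performs, for $t=1,2,\dots$: (1) if $r_{t-1}^\top A r_{t-1}\le 0$ (non-positive curvature is detected), stop and return $d=\|b\|\, r_{t-1}/\|r_{t-1}\|$ with flag NPC; (2) otherwise compute $p_t$; if $\|r_t\|\le\theta\|b\|$, stop and return $d=p_t$ with flag SOL; otherwise continue with $t+1$. MINRES-based linesearch method. Input: $x_0\in\mathbb{R}^n$, $\rho,\sigma\in(0,1)$,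 $\alpha\in(0,1]$, $\mathsf A\in(0,1]$, $s>0$, tolerances $\theta_k\ge0$, parameters $a_k\ge\bar a>0$, and $\zeta_k\ge 0$. For $k=0,1,\dots$: set $g_k=\nabla f(x_k)$, choose $B_k\in\mathbb S_n$ (an approximation of $\nabla^2 f(x_k)$), and set $\bar B_k=B_k+\zeta_k I$. If $g_k=0$, stop. Otherwise compute $(d_k,\mathrm{flag}_k)$ by $\mathrm{MINRES}(\bar B_k,-g_k,\theta_k)$. If $\mathrm{flag}_k=\mathrm{SOL}$ and $d_k^\top\bar B_kd_k<\min\{\mathsf A,a_k\|g_k\|^{\alpha}\}\|d_k\|^2$, then reset $d_k=-g_k$ and $\mathrm{flag}_k=\mathrm{GD}$. Determine the step size $\lambda_k$ as follows and set $x_{k+1}=x_k+\lambda_kd_k$: - If $\mathrm{flag}_k\in\{\mathrm{SOL},\mathrm{GD}\}$: $\lambda_k=s\rho^j$ with $j\ge0$ the smallest integer such that $f(x_k+\lambda_kd_k)-f(x_k)\le\sigma\lambda_kd_k^\top g_k$. - If $\mathrm{flag}_k=\mathrm{NPC}$: consider the condition $(\ast)$ $f(x_k+\lambda d_k)-f(x_k)\le\sigma\lambda g_k^\top d_k+\frac{\sigma}{2}\lambda^2d_k^\top B_kd_k$. If $(\ast)$ fails for $\lambda=s$, then $\lambda_k=s\rho^j$ with $j$ the smallest positive integer such that $(\ast)$ holds for $\lambda = s\rho^j$. If $(\ast)$ holds for $\lambda=s$, then $\lambda_k=s\rho^{-j}$ with $j\ge0$ the largest integer such that $(\ast)$ holds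 for all $\lambda=s,s\rho^{-1},\dots,s\rho^{-j}$ (forward linesearch). Whenever the method is said to generate $\{x_k\}$, it is implicitly assumed that each forward linesearch stops after finitely many steps. *)

(* Defs.v *)
From HB Require Import structures.
From mathcomp Require Import all_boot all_order all_algebra.
From mathcomp Require Import all_classical all_reals all_analysis.

Set Implicit Arguments.
Unset Strict Implicit.
Unset Printing Implicit Defensive.

Import Order.TTheory GRing.Theory Num.Theory.
Import numFieldNormedType.Exports.

Local Open Scope classical_set_scope.
Local Open Scope ring_scope.

(* The library norm [`| v |] on matrices is the sup norm, hence the Euclidean
   and spectral norms below; the topologies agree. *)
Definition dot {R : realType} {n : nat} (u v : 'cV[R]_n) : R :=
  (u^T *m v) 0 0.

Definition enorm {R : realType} {n : nat} (v : 'cV[R]_n) : R :=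
  Num.sqrt (dot v v).

Definition spectral_norm {R : realType} {n : nat} (A : 'M[R]_n) : R :=
  sup [set enorm (A *m v) | v in [set v | enorm v <= 1]].

Definition grad {R : realType} {n : nat} (f : 'cV[R]_n -> R) (x : 'cV[R]_n) :
    'cV[R]_n :=
  \col_i 'D_(delta_mx i 0) f x.

Definition hess {R : realType} {n : nat} (f : 'cV[R]_n -> R) (x : 'cV[R]_n) :
    'M[R]_n :=
  \matrix_(i, j) 'D_(delta_mx j 0) (fun y => grad f y i 0) x.

Definition twice_continuously_differentiable {R : realType} {n : nat}
    (f : 'cV[R]_n -> R) : Prop :=
  [/\ forall x, differentiable f x,
      forall x, differentiable (grad f) x
    & continuous (hess f)].

(* The class of desingularizing functions on [0, eta[, with eta in ]0, +oo];
   values of [phi] outside [0, eta[ are irrelevant. *)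
Definition desingularizing {R : realType} (eta : \bar R) (phi : R -> R) :
    Prop :=
  let dom := [set t : R | 0 <= t /\ (t%:E < eta)%E] in
  let inner := [set t : R | 0 < t /\ (t%:E < eta)%E] in
  [/\ {within dom, continuous phi},
      forall t, dom t -> 0 <= phi t,
      convex_function (E := R^o) dom (\- phi),
      forall t, inner t -> derivable phi t 1 /\ {for t, continuous (derive1 phi)}
    & phi 0 = 0 /\ forall t, inner t -> 0 < derive1 phi t].

Definition KL_property {R : realType} {n : nat} (f : 'cV[R]_n -> R)
    (xbar : 'cV[R]_n) : Prop :=
  exists (eta : \bar R) (V : set 'cV[R]_n) (phi : R -> R),
    [/\ (0 < eta)%E, nbhs xbar V, desingularizing eta phi
      & forall x, V x -> 0 < f x - f xbar -> ((f x - f xbar)%:E < eta)%E ->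
          1 <= derive1 phi (f x - f xbar) * enorm (grad f x)].

Definition krylov {R : realType} {n : nat} (A : 'M[R]_n) (b : 'cV[R]_n)
    (t : nat) : {vspace 'cV[R]_n} :=
  <<mkseq (fun i => A ^+ i *m b) t>>%VS.

Definition is_residual_argmin {R : realType} {n : nat} (A : 'M[R]_n)
    (b : 'cV[R]_n) (t : nat) (p : 'cV[R]_n) : Prop :=
  p \in krylov A b t /\
  forall q, q \in krylov A b t -> enorm (b - A *m p) <= enorm (b - A *m q).

Inductive flag := SOL | NPC | GD.

(* [minres_returns A b theta d fl]: MINRES(A, b, theta) stops and returns
   (d, fl). The witness [t] is the index before the last one performed: the
   routine passes the iterations 1, ..., t without stopping and stops in
   iteration t + 1. [krylov A b 0] is the zero space, so [p 0] = 0. *)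
Definition minres_returns {R : realType} {n : nat} (A : 'M[R]_n)
    (b : 'cV[R]_n) (theta : R) (d : 'cV[R]_n) (fl : flag) : Prop :=
  exists (p : nat -> 'cV[R]_n) (t : nat),
    let r i := b - A *m p i in
    [/\ forall i, is_residual_argmin A b i (p i),
        forall i, (i < t)%N ->
          0 < dot (r i) (A *m r i) /\ theta * enorm b < enorm (r i.+1)
      & match fl with
        | NPC => dot (r t) (A *m r t) <= 0 /\
                 d = (enorm b / enorm (r t)) *: r t
        | SOL => [/\ 0 < dot (r t) (A *m r t),
                     enorm (r t.+1) <= theta * enorm b
                   & d = p t.+1]
        | GD => False
        end].

(* The direction of one iteration: MINRES followed by the safeguard, with
   [tau] the curvature threshold min{A, a_k |g_k|^alpha}. *)
Definition direction {R : realType} {n : nat} (Bbar : 'M[R]_n)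
    (g : 'cV[R]_n) (theta tau : R) (d : 'cV[R]_n) (fl : flag) : Prop :=
  exists d0 fl0, minres_returns Bbar (- g) theta d0 fl0 /\
    (d, fl) = if fl0 is SOL
              then if dot d0 (Bbar *m d0) < tau * enorm d0 ^+ 2
                   then (- g, GD) else (d0, SOL)
              else (d0, fl0).

Definition is_smallest (P : nat -> Prop) (j : nat) : Prop :=
  P j /\ forall i, P i -> (j <= i)%N.

Definition is_largest (P : nat -> Prop) (j : nat) : Prop :=
  P j /\ forall i, P i -> (i <= j)%N.

Definition armijo {R : realType} {n : nat} (f : 'cV[R]_n -> R) (sigma : R)
    (x d : 'cV[R]_n) (lambda : R) : Prop :=
  f (x + lambda *: d) - f x <= sigma * lambda * dot d (grad f x).

Definition curvature_decrease {R : realType} {n : nat} (f : 'cV[R]_n -> R)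
    (sigma : R) (B : 'M[R]_n) (x d : 'cV[R]_n) (lambda : R) : Prop :=
  f (x + lambda *: d) - f x <=
    sigma * lambda * dot (grad f x) d +
    sigma / 2 * lambda ^+ 2 * dot d (B *m d).

Definition step_size {R : realType} {n : nat} (f : 'cV[R]_n -> R)
    (rho sigma s : R) (B : 'M[R]_n) (x d : 'cV[R]_n) (fl : flag)
    (lambda : R) : Prop :=
  match fl with
  | SOL | GD =>
      exists2 j, is_smallest (fun j => armijo f sigma x d (s * rho ^+ j)) j
               & lambda = s * rho ^+ j
  | NPC =>
      let C := curvature_decrease f sigma B x d in
      (~ C s ->
         exists2 j, is_smallest (fun j => (0 < j)%N /\ C (s * rho ^+ j)) j
                  & lambda = s * rho ^+ j) /\
      (C s ->
         exists2 j, is_largest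
                      (fun j => forall i, (i <= j)%N -> C (s * rho ^- i)) j
                  & lambda = s * rho ^- j)
  end.

Definition iteration {R : realType} {n : nat} (f : 'cV[R]_n -> R)
    (rho sigma alpha Acap s theta a zeta : R) (B : 'M[R]_n)
    (x x' : 'cV[R]_n) : Prop :=
  let g := grad f x in
  let Bbar := B + zeta%:M in
  exists (d : 'cV[R]_n) (fl : flag) (lambda : R),
    [/\ direction Bbar g theta (Num.min Acap (a * enorm g `^ alpha)) d fl,
        step_size f rho sigma s B x d fl lambda
      & x' = x + lambda *: d].

(* A run that stops in iteration K is represented by the sequence
   x_0, ..., x_K, x_K, x_K, ... *)
Definition generated {R : realType} {n : nat} (f : 'cV[R]_n -> R)
    (rho sigma alpha Acap s : R) (theta a zeta : nat -> R)
    (B : nat -> 'M[R]_n) (x : nat -> 'cV[R]_n) : Prop :=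
  forall k,
    (grad f (x k) = 0 -> x k.+1 = x k) /\
    (grad f (x k) <> 0 ->
       iteration f rho sigma alpha Acap s (theta k) (a k) (zeta k) (B k)
         (x k) (x k.+1)).

Definition stops_at {R : realType} {n : nat} (f : 'cV[R]_n -> R)
    (x : nat -> 'cV[R]_n) (K : nat) : Prop :=
  grad f (x K) = 0 /\ forall k, (k < K)%N -> grad f (x k) <> 0.

Definition accumulation_points {R : realType} {n : nat}
    (x : nat -> 'cV[R]_n) : set 'cV[R]_n :=
  [set y | limn_einf (fun k => (enorm (x k - y))%:E) = 0%E].

(* Main.v *)
Require Import Defs.
From mathcomp Require Import all_boot all_order all_algebra.
From mathcomp Require Import all_classical all_reals all_analysis.
From mathcomp Require Import ring lra.

Set Implicit Arguments.
Unset Strict Implicit.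
Unset Printing Implicit Defensive.

Import Order.TTheory GRing.Theory Num.Theory.
Import numFieldNormedType.Exports.

Local Open Scope classical_set_scope.
Local Open Scope ring_scope.

(** Write g_k for the gradient at x_k and f_star for the value at the
    accumulation point x*. The values f(x_k) decrease strictly (every direction
    is a descent direction) and tend to f_star, so they stay above f_star as long
    as the method does not stop.

    The heart of the proof is one estimate on a single iteration,
    [step_length_bound]: if f(x_k) - f(x_{k+1}) <= |g_k| D, then
    |x_{k+1} - x_k| <= C (D + a_k^(-1/alpha) + b_k^(-1/beta) + z_k^(-1/zeta)),
    with C independent of k. When the thresholds min{A, a_k |g_k|^alpha} and
    min{B, b_k |g_k|^beta} have reached their caps A and B, the direction d_k
    makes an angle bounded away from a right angle with -g_k, and the decrease
    dominates |g_k| times the step; this gives the term C D. When a cap is not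
    reached, |g_k| itself is bounded by a multiple of one of the three summable
    quantities. Then a direction of type SOL is short and its step size is at
    most s; a direction of type NPC may be followed by an arbitrarily long
    forward step, but there the decrease contains a multiple of zeta_k times
    the squared step length, and the inequality of the means turns this into
    the bound above.

    The Kurdyka-Lojasiewicz inequality and the concavity of the desingularizing
    function phi allow D to be the decrement of phi(f(x_k) - f_star), a
    telescoping quantity. Close to x* the total length of the steps is therefore
    as small as desired, so the iterates that come near x* at a late index remain there:
    [trapped_converges] and [KL_convergence].

    Finally, if the gradient at x* were not zero, all the relevant caps would
    be reached eventually, hence the directions would be bounded away from zero
    in length and in angle. As the steps tend to zero, the step sizes drop below
    s, which means that the preceding trial step was rejected; by the mean value
    theorem this forces the gradient to vary by a fixed amount over a distance
    tending to zero, a contradiction ([limit_stationary]).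

    SOL directions are descent directions because the iterates p_t of MINRES
    satisfy r_t . p_t >= 0 as long as no nonpositive curvature was met
    ([residual_iterate_ge0]); this makes -g . d at least d . A d. *)

(** * Euclidean geometry of column vectors *)

Section Euclid.
Context {R : realType} {n : nat}.
Implicit Types (u v w : 'cV[R]_n) (A : 'M[R]_n).

Lemma dotE u v : dot u v = \sum_i u i 0 * v i 0.
Proof. by rewrite /dot mxE; apply: eq_bigr => i _; rewrite mxE. Qed.

Lemma dotC u v : dot u v = dot v u.
Proof. by rewrite !dotE; apply: eq_bigr => i _; rewrite mulrC. Qed.

Lemma dotDl u v w : dot (u + v) w = dot u w + dot v w.
Proof. by rewrite /dot linearD mulmxDl mxE. Qed.

Lemma dotZl c u v : dot (c *: u) v = c * dot u v.
Proof. by rewrite /dot linearZ /= -scalemxAl mxE. Qed.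

Lemma dotNl u v : dot (- u) v = - dot u v.
Proof. by rewrite -scaleN1r dotZl mulN1r. Qed.

Lemma dotBl u v w : dot (u - v) w = dot u w - dot v w.
Proof. by rewrite dotDl dotNl. Qed.

Lemma dotDr u v w : dot w (u + v) = dot w u + dot w v.
Proof. by rewrite !(dotC w) dotDl. Qed.

Lemma dotZr c u v : dot u (c *: v) = c * dot u v.
Proof. by rewrite !(dotC u) dotZl. Qed.

Lemma dotNr u v : dot u (- v) = - dot u v.
Proof. by rewrite !(dotC u) dotNl. Qed.

Lemma dotBr u v w : dot w (u - v) = dot w u - dot w v.
Proof. by rewrite dotDr dotNr. Qed.

Lemma dot0l v : dot 0 v = 0.
Proof. by rewrite -(scale0r v) dotZl mul0r. Qed.

Lemma dot0r v : dot v 0 = 0.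
Proof. by rewrite dotC dot0l. Qed.

Lemma dot_sumr u (I : Type) (s : seq I) (P : pred I) (F : I -> 'cV[R]_n) :
  dot u (\sum_(i <- s | P i) F i) = \sum_(i <- s | P i) dot u (F i).
Proof.
by elim/big_rec2: _ => [|i a b _ <-]; rewrite ?dot0r ?dotDr.
Qed.

Lemma dot_mulmx_sym A u v : A^T = A -> dot u (A *m v) = dot (A *m u) v.
Proof. by move=> As; rewrite /dot trmx_mul As mulmxA. Qed.

Lemma dot_ge0 v : 0 <= dot v v.
Proof. by rewrite dotE sumr_ge0 // => i _; rewrite -expr2 sqr_ge0. Qed.

Lemma enorm_ge0 v : 0 <= enorm v.
Proof. exact: sqrtr_ge0. Qed.

Lemma enorm_sqr v : enorm v ^+ 2 = dot v v.
Proof. by rewrite sqr_sqrtr ?dot_ge0. Qed.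

Lemma enorm0 : enorm (0 : 'cV[R]_n) = 0.
Proof. by rewrite /enorm dot0l sqrtr0. Qed.

Lemma coord_le_enorm v i : `|v i 0| <= enorm v.
Proof.
rewrite -ler_sqr ?nnegrE ?enorm_ge0 // real_normK ?num_real // enorm_sqr dotE.
rewrite (bigD1 i) //= expr2 lerDl sumr_ge0 // => j _.
by rewrite -expr2 sqr_ge0.
Qed.

Lemma enorm_eq0 v : enorm v = 0 -> v = 0.
Proof.
move=> v0; apply/matrixP => i j; rewrite mxE ord1; apply/eqP.
by rewrite -normr_le0 -v0 coord_le_enorm.
Qed.

Lemma enorm_gt0 v : v <> 0 -> 0 < enorm v.
Proof.
move=> v0; rewrite lt0r enorm_ge0 andbT; apply/eqP => /enorm_eq0; exact: v0.
Qed.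

Lemma enormZ c v : enorm (c *: v) = `|c| * enorm v.
Proof.
by rewrite /enorm dotZl dotZr mulrA -expr2 sqrtrM ?sqr_ge0 // sqrtr_sqr.
Qed.

Lemma enormN v : enorm (- v) = enorm v.
Proof. by rewrite /enorm dotNl dotNr opprK. Qed.

Lemma enormBC u v : enorm (u - v) = enorm (v - u).
Proof. by rewrite -enormN opprB. Qed.

Lemma dot_le_enorm u v : dot u v <= enorm u * enorm v.
Proof.
have := enorm_ge0 u; have := enorm_ge0 v.
rewrite !le0r => /orP[/eqP /enorm_eq0 ->|v0]; first by rewrite dot0r enorm0 mulr0.
case/orP => [/eqP /enorm_eq0 ->|u0]; first by rewrite dot0l enorm0 mul0r.
have := dot_ge0 (enorm v *: u - enorm u *: v); rewrite dotBl !dotBr !dotZl !dotZr (dotC v u) -!enorm_sqr.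
have p : 0 < enorm u * enorm v by rewrite mulr_gt0.
by move=> h; rewrite -(ler_pM2l p); nra.
Qed.

Lemma ler_enormD u v : enorm (u + v) <= enorm u + enorm v.
Proof.
rewrite -ler_sqr ?nnegrE ?addr_ge0 ?enorm_ge0 // enorm_sqr.
rewrite dotDl !dotDr (dotC v u) -!enorm_sqr.
have := dot_le_enorm u v; lra.
Qed.

Lemma ler_enormB u v : enorm u - enorm v <= enorm (u - v).
Proof. by rewrite lerBlDr -{1}(subrK v u) ler_enormD. Qed.

Lemma ler_enorm_sum (I : Type) (s : seq I) (P : pred I) (F : I -> 'cV[R]_n) :
  enorm (\sum_(i <- s | P i) F i) <= \sum_(i <- s | P i) enorm (F i).
Proof.
elim/big_rec2: _ => [|i y1 y2 _ h]; first by rewrite enorm0.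
by rewrite (le_trans (ler_enormD _ _)) // lerD2l.
Qed.

Lemma enorm_le_sum v : enorm v <= \sum_i `|v i 0|.
Proof.
have {1}-> : v = \sum_i v i 0 *: delta_mx i 0.
  by rewrite {1}[v]matrix_sum_delta; apply: eq_bigr => i _; rewrite big_ord1.
apply: le_trans (ler_enorm_sum _ _ _) _; apply: ler_sum => i _.
suff -> : enorm (v i 0 *: delta_mx i 0) = `|v i 0| by exact: lexx.
rewrite enormZ /enorm dotE (bigD1 i) //= big1 => [|j ji].
  by rewrite !mxE !eqxx mulr1 addr0 sqrtr1 mulr1.
by rewrite !mxE (negPf ji) mul0r.
Qed.

(** The topology of column vectors is induced by the sup norm; the two
    comparisons below make it the Euclidean topology. *)
Lemma normr_le_enorm v : `|v| <= enorm v.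
Proof.
rewrite [leLHS]/Num.Def.normr/= mx_normrE bigmax_le ?enorm_ge0 // => -[i j] _ /=.
by rewrite ord1 coord_le_enorm.
Qed.

Lemma enorm_le_normr v : enorm v <= n%:R * `|v|.
Proof.
apply: le_trans (enorm_le_sum _) _.
rewrite -[n in n%:R]card_ord -sum1_card natr_sum mulr_suml ler_sum // => i _.
rewrite mul1r [leRHS]/Num.Def.normr/= mx_normrE.
exact: (le_bigmax _ _ (i, 0)).
Qed.

(** The supremum that defines the spectral norm is taken over a bounded set:
    the sum of the absolute values of all entries of [A] is an upper bound. The
    inequality then follows by homogeneity. *)
Lemma spectral_norm_bound A v : enorm (A *m v) <= spectral_norm A * enorm v.
Proof.
have [->|v0] := eqVneq v 0; first by rewrite mulmx0 enorm0 mulr0.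
have pv : 0 < enorm v by apply: enorm_gt0; exact/eqP.
rewrite -ler_pdivrMr //.
have -> : enorm (A *m v) / enorm v = enorm (A *m ((enorm v)^-1 *: v)).
  by rewrite -scalemxAr enormZ gtr0_norm ?invr_gt0 // mulrC.
apply: ub_le_sup; last first.
  exists ((enorm v)^-1 *: v) => //=.
  by rewrite enormZ gtr0_norm ?invr_gt0 // mulVf // gt_eqF.
exists (\sum_i \sum_j `|A i j|) => _ [w /= w1 <-].
apply: le_trans (enorm_le_sum _) _; apply: ler_sum => i _.
rewrite mxE; apply: le_trans (ler_norm_sum _ _ _) _; apply: ler_sum => j _.
by rewrite normrM ler_piMr // (le_trans (coord_le_enorm _ _)).
Qed.

Lemma nbhs_enorm_ball v (V : set 'cV[R]_n) :
  nbhs v V -> exists2 e, 0 < e & forall w, enorm (w - v) < e -> V w.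
Proof.
case/nbhs_normP => e /= e0 h; exists e => // w we; apply: h.
by rewrite /= distrC; apply: le_lt_trans we; exact: normr_le_enorm.
Qed.

Lemma cvg_enormP (x : nat -> 'cV[R]_n) v :
  (forall e, 0 < e -> exists K, forall k, (K <= k)%N -> enorm (x k - v) < e) ->
  x @ \oo --> v.
Proof.
move=> h; apply/cvgrPdist_lt => e e0; have [K hK] := h e e0.
exists K => // k /= Kk; rewrite distrC.
by apply: le_lt_trans (hK k Kk); exact: normr_le_enorm.
Qed.

Lemma continuous_enorm_ball (g : 'cV[R]_n -> 'cV[R]_n) v :
  {for v, continuous g} -> forall e, 0 < e -> exists2 r, 0 < r &
    forall w, enorm (w - v) < r -> enorm (g w - g v) < e.
Proof.
move=> gc e e0.
have e1 : 0 < e / n.+1%:R by rewrite divr_gt0.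
have /cvgrPdist_lt/(_ _ e1) /nbhs_enorm_ball[r r0 hr] := gc.
exists r => // w /hr /= h; rewrite enormBC.
apply: le_lt_trans (enorm_le_normr _) _.
move: h; rewrite ltr_pdivlMr // mulrC; apply: le_lt_trans.
by rewrite ler_wpM2r // ler_nat.
Qed.

End Euclid.

(** * MINRES iterates and residuals *)

Section Minres.
Context {R : realType} {n : nat}.
Variables (A : 'M[R]_n) (b : 'cV[R]_n) (p : nat -> 'cV[R]_n).
Hypothesis A_sym : A^T = A.
Hypothesis p_argmin : forall i, is_residual_argmin A b i (p i).
Let r i := b - A *m p i.

Lemma krylov_mono i j : (i <= j)%N -> (krylov A b i <= krylov A b j)%VS.
Proof.
move=> ij; apply: sub_span => v /mapP[k]; rewrite mem_iota add0n /= => ki ->.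
by apply: map_f; rewrite mem_iota add0n (leq_trans ki).
Qed.

Lemma krylov_start i : b \in krylov A b i.+1.
Proof.
apply: memv_span; apply/mapP; exists 0%N; first by rewrite mem_iota.
by rewrite expr0 mul1mx.
Qed.

Lemma krylov_mulmx i q : q \in krylov A b i -> A *m q \in krylov A b i.+1.
Proof.
move=> /coord_span ->; rewrite mulmx_sumr memv_suml // => j _.
rewrite -scalemxAr memvZ // memv_span //.
have ji : (j < i)%N by exact: ltn_ord.
rewrite nth_mkseq // mulmxA -[A *m A ^+ j]/(A * A ^+ j) -exprS.
by apply/mapP; exists j.+1; rewrite ?mem_iota.
Qed.

Lemma residual_mem i : r i \in krylov A b i.+1.
Proof.
rewrite rpredB ?krylov_start // krylov_mulmx //.
by have [] := p_argmin i.
Qed.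

(** Otherwise a move of the iterate along [q], by the step
    (r . A q) / |A q|^2, would lower the squared residual by
    (r . A q)^2 / |A q|^2. *)
Lemma residual_orth i q : q \in krylov A b i -> dot (r i) (A *m q) = 0.
Proof.
move=> qK; have [pK pmin] := p_argmin i.
have [Aq0|Aq0] := eqVneq (A *m q) 0; first by rewrite Aq0 dot0r.
have Aqp : 0 < dot (A *m q) (A *m q).
  by rewrite -enorm_sqr exprn_gt0 // enorm_gt0 //; exact/eqP.
(* The minimizer of the residual norm on the line through [p i] along [q]. *)
have := pmin (p i + (dot (r i) (A *m q) / dot (A *m q) (A *m q)) *: q)
  (rpredD pK (rpredZ _ qK)).
rewrite mulmxDr opprD addrA -scalemxAr -/(r i).
rewrite -ler_sqr ?nnegrE ?enorm_ge0 // !enorm_sqr.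
move: (r i) => w; rewrite dotBl !dotBr !dotZl !dotZr (dotC (A *m q) w).
set c := dot w (A *m q); set e := dot (A *m q) _ in Aqp *.
have -> : dot w w - c / e * c - (c / e * c - c / e * (c / e * e)) =
          dot w w - c ^+ 2 / e by field; rewrite gt_eqF.
rewrite lerBrDr gerDl => h.
have : c ^+ 2 <= 0 by rewrite -(pmulr_lle0 _ (_ : 0 < e^-1)) ?invr_gt0 // mulrC.
by move=> h2; apply/eqP; rewrite -sqrf_eq0 eq_le h2 sqr_ge0.
Qed.

(** The difference of the two residuals lies in the image under [A] of the
    [i]-th Krylov space, which is orthogonal to the [i]-th residual. *)
Lemma residual_dot i j : (j <= i)%N -> dot (r i) (r j) = enorm (r i) ^+ 2.
Proof.
move=> ji; rewrite enorm_sqr; apply/eqP; rewrite -subr_eq0 -dotBr.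
have -> : r j - r i = A *m (p i - p j).
  by rewrite /r mulmxBr opprB addrC addrA subrK.
rewrite residual_orth // rpredB //; first by have [] := p_argmin i.
by apply: (subvP (krylov_mono ji)); have [] := p_argmin j.
Qed.

Lemma minres_iterate0 : p 0%N = 0.
Proof.
have [] := p_argmin 0; rewrite /krylov /mkseq /= span_nil memv0 => /eqP ->//.
Qed.

Lemma residual0 : r 0%N = b.
Proof. by rewrite /r minres_iterate0 mulmx0 subr0. Qed.

Lemma residual_mono i j : (j <= i)%N -> enorm (r i) <= enorm (r j).
Proof.
move=> ji; have [_] := p_argmin i; apply.
by apply: (subvP (krylov_mono ji)); have [] := p_argmin j.
Qed.

(** For j < i the residual [r j] belongs to the [i]-th Krylov space, so this is
    an instance of the optimality condition. *)
Lemma residual_A_orth i j : i != j -> dot (r i) (A *m r j) = 0.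
Proof.
wlog : i j / (j < i)%N => [hw ij|ji _].
  have [ji|ij'|/eqP e] := ltngtP j i; [exact: hw| |by rewrite eq_sym (negPf ij) in e].
  by rewrite dot_mulmx_sym // dotC hw // eq_sym.
by rewrite residual_orth // (subvP (krylov_mono ji)) // residual_mem.
Qed.

(** Being [A]-orthogonal with positive curvature, the residuals are linearly
    independent, and there are as many of them as there are generators of the
    Krylov space. *)
Lemma krylov_residual_span t :
  (forall j, (j < t)%N -> 0 < dot (r j) (A *m r j)) ->
  forall q, q \in krylov A b t -> exists c : 'I_t -> R, q = \sum_i c i *: r i.
Proof.
move=> rpos q qK.
pose X := [tuple r i | i < t].
have Xi (i : 'I_t) : X`_i = r i by rewrite -tnth_nth tnth_mktuple.
have Xfree : free X.
  apply/freeP => k k0 i.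
  have := congr1 (fun v => dot v (A *m r i)) k0.
  rewrite /= dot0l dotC dot_sumr (bigD1 i) //= big1 => [|j ji].
    rewrite Xi dotZr dotC addr0 => /eqP; rewrite mulf_eq0 => /orP[/eqP //|].
    by rewrite gt_eqF // rpos.
  by rewrite Xi dotZr dotC residual_A_orth ?mulr0.
have XK : (<<X>> <= krylov A b t)%VS.
  apply/span_subvP => v /tnthP[i ->]; rewrite tnth_mktuple.
  by apply: (subvP (krylov_mono (ltn_ord i))); exact: residual_mem.
have /eqP XE : <<X>>%VS == krylov A b t.
  rewrite eqEdim XK (eqP Xfree) size_tuple.
  by rewrite -[leqRHS](size_mkseq (fun i => A ^+ i *m b)) dim_span.
move: qK; rewrite -XE => /coord_span ->.
by exists (fun i => coord X i q); apply: eq_bigr => i _; rewrite Xi.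
Qed.

(** In the basis of residuals the [i]-th coefficient of [p t] is
    (|r_i|^2 - |r_t|^2) / (r_i . A r_i), which is nonnegative because residual
    norms decrease; and r_t . r_i = |r_t|^2 is nonnegative too. *)
Lemma residual_iterate_ge0 t :
  (forall j, (j < t)%N -> 0 < dot (r j) (A *m r j)) -> 0 <= dot (r t) (p t).
Proof.
move=> rpos; have [pK _] := p_argmin t.
have [c pE] := krylov_residual_span rpos pK.
rewrite pE dot_sumr sumr_ge0 // => i _.
rewrite dotZr (residual_dot (ltnW (ltn_ord i))) mulr_ge0 ?sqr_ge0 //.
rewrite -(pmulr_lge0 _ (rpos i (ltn_ord i))).
have -> : c i * dot (r i) (A *m r i) = dot (r i) (A *m p t).
  rewrite pE mulmx_sumr dot_sumr (bigD1 i) //= big1 => [|j ji].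
    by rewrite addr0 -scalemxAr dotZr.
  by rewrite -scalemxAr dotZr residual_A_orth ?mulr0 // eq_sym.
have -> : A *m p t = r 0 - r t by rewrite residual0 opprB addrC subrK.
rewrite dotBr (residual_dot (leq0n i)) (dotC (r i)).
rewrite (residual_dot (ltnW (ltn_ord i))) subr_ge0 ler_sqr ?nnegrE ?enorm_ge0 //.
exact/residual_mono/ltnW.
Qed.

End Minres.

(** * Search directions *)

Section Direction.
Context {R : realType} {n : nat}.
Variables (A : 'M[R]_n) (g : 'cV[R]_n) (theta tau L : R).
Hypothesis A_sym : A^T = A.
Hypothesis A_bound : forall v, enorm (A *m v) <= L * enorm v.
Hypothesis g_neq0 : g <> 0.
Hypothesis theta_ge0 : 0 <= theta.

Let g_gt0 : 0 < enorm g. Proof. exact: enorm_gt0. Qed.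

(** A residual satisfies b . r_t = |r_t|^2, so after scaling to the length of
    [g] the slope is -|g| |r_t|; and |r_t| exceeds theta |g| unless t = 0, where
    the residual is -g itself. *)
Lemma direction_NPC d : direction A g theta tau d NPC ->
  [/\ enorm d = enorm g, dot d (A *m d) <= 0 &
      Num.min 1 theta * enorm g ^+ 2 <= - dot g d].
Proof.
case=> d0 [fl0 [[p [t [pmin pass stop]]]]].
case: fl0 stop; [by move=> _; case: ifP|case=> npc -> [->]|by []].
set r := - g - A *m p t in npc *.
have rt : Num.min 1 theta * enorm g <= enorm r.
  rewrite /r; case: t pass {npc r} => [_|t pass].
    rewrite (residual0 pmin) enormN -[leRHS]mul1r ler_wpM2r ?enorm_ge0 //.
    by rewrite ge_min lexx.
  have [_ /ltW] := pass t (ltnSn t).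
  apply: le_trans; rewrite enormN ler_wpM2r ?enorm_ge0 //.
  by rewrite ge_min lexx orbT.
have r0 : 0 < enorm r.
  rewrite /r; case: t pass {npc rt r} => [_|t pass].
    by rewrite (residual0 pmin) enormN.
  have [_] := pass t (ltnSn t); apply: le_lt_trans.
  by rewrite mulr_ge0 ?enorm_ge0.
split.
- by rewrite enormZ enormN gtr0_norm ?divr_gt0 // divfK ?gt_eqF.
- rewrite -scalemxAr dotZl dotZr mulrA -expr2.
  by rewrite mulr_ge0_le0 ?sqr_ge0.
- rewrite dotZr -mulrN -dotNl enormN -{1}(residual0 pmin) dotC.
  rewrite (residual_dot pmin) //= -/r expr2 [X in _ <= X]mulrA.
  by rewrite divfK ?gt_eqF // mulrA [leRHS]mulrC ler_wpM2r ?enorm_ge0.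
Qed.

Lemma direction_GD d : direction A g theta tau d GD -> d = - g.
Proof.
case=> d0 [fl0 [[p [t [pmin pass stop]]]]].
by case: fl0 stop => // _; case: ifP => // _ [].
Qed.

(** With b = - g = r + A d, the slope bound comes from r . d >= 0. The last two
    conclusions bound the direction from below. If theta < 1, the small residual
    forces |A d| >= (1 - theta) |g|. If theta >= 1, MINRES stops at its first
    iteration, so [d] is parallel to [g] and inherits the curvature safeguard,
    g . A g >= tau |g|^2, while the optimality condition bounds g . A g by
    |A d| |A g|. *)
Lemma direction_SOL d : direction A g theta tau d SOL ->
  [/\ 0 < enorm d, tau * enorm d ^+ 2 <= - dot g d,
      tau * enorm d <= enorm g, (1 - theta) * enorm g <= L * enorm d &
      1 <= theta -> tau * enorm g <= L ^+ 2 * enorm d].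
Proof.
case=> d0 [fl0 [[p [t [pmin pass stop]]]]].
case: fl0 stop; [case=> curv small ->|by case|by []].
case: ifP => // /negbT; rewrite -leNgt => safe [->].
set d' := p t.+1 in safe *.
set r := - g - A *m d' in small.
have rpos j : (j < t.+1)%N ->
    0 < dot (- g - A *m p j) (A *m (- g - A *m p j)).
  by rewrite ltnS leq_eqVlt => /orP[/eqP -> //|jt]; have [] := pass j jt.
have rd : 0 <= dot r d' by exact: (residual_iterate_ge0 A_sym pmin rpos).
have gE : - g = r + A *m d' by rewrite /r subrK.
have descent : dot d' (A *m d') <= - dot g d'.
  by rewrite -dotNl gE dotDl (dotC (A *m d')) lerDr.
have gKt : - g \in krylov A (- g) t.+1 by exact: krylov_start.
have orth : dot r (A *m - g) = 0 by rewrite (residual_orth pmin).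
have gcurv : 0 < dot g (A *m g).
  have := rpos 0 isT.
  by rewrite (residual0 pmin) mulmxN dotNl dotNr opprK.
have Adg : dot g (A *m g) <= L ^+ 2 * enorm d' * enorm g.
  have -> : dot g (A *m g) = dot (A *m d') (A *m - g).
    by rewrite -[LHS]opprK -dotNl -dotNr -mulmxN {1}gE dotDl orth add0r.
  apply: le_trans (dot_le_enorm _ _) _.
  rewrite expr2 -mulrA mulrACA.
  by rewrite ler_pM ?enorm_ge0 ?A_bound // -(enormN g) A_bound.
have d0p : 0 < enorm d'.
  rewrite lt0r enorm_ge0 andbT; apply/eqP => dz.
  by move: Adg; rewrite dz mulr0 mul0r leNgt gcurv.
split=> //.
- exact: le_trans safe descent.
- have : tau * enorm d' ^+ 2 <= enorm g * enorm d'.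
    apply: le_trans safe (le_trans descent _).
    by rewrite -dotNl -(enormN g) dot_le_enorm.
  by rewrite expr2 mulrA ler_pM2r.
- have := ler_enormB (- g) (A *m d'); rewrite -/r.
  have := A_bound d'; rewrite !enormN in small *; lra.
- move=> theta1; have t0 : t = 0%N.
    case: t {d' r safe small rpos rd gE descent orth gKt Adg d0p curv} pass => //.
    (* Passing the first iteration would need theta |g| < |r_1| <= |g|. *)
    move=> t /(_ 0%N isT) [_] /lt_le_trans /(_ (residual_mono pmin (leq0n _))).
    by rewrite (residual0 pmin) gtr_pMl ?enormN // ltNge theta1.
  have [dK _] := pmin 1%N.
  have [c dE] : exists c, d' = c *: g.
    move: dK; rewrite /krylov /mkseq /= expr0 mul1mx span_seq1 => /vlineP[c].
    by rewrite /d' t0 => ->; exists (- c); rewrite scalerN scaleNr.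
  move: safe; rewrite dE enormZ -scalemxAr dotZl dotZr mulrA -expr2 exprMn.
  rewrite real_normK ?num_real // mulrCA ler_pM2l => [safe|]; last first.
    rewrite lt0r sqr_ge0 andbT sqrf_eq0; apply: contraTneq d0p => c0.
    by rewrite dE c0 scale0r enorm0 ltxx.
  rewrite -(ler_pM2r g_gt0) -mulrA -expr2; apply: le_trans safe _.
  by rewrite -enormZ -dE.
Qed.

End Direction.

(** * Thresholds that are not reached *)

Section Thresholds.
Context {R : realType}.
Implicit Types a c p t : R.

(** While the threshold [c] is not reached, [t] is controlled by the quantity
    [a `^ (- p^-1)], which is the summable one in the applications. *)
Lemma threshold_size a c p t : 0 < a -> 0 < p -> 0 < t ->
  a * t `^ p < c -> t <= c `^ p^-1 * a `^ (- p^-1).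
Proof.
move=> a0 p0 t0 /ltW h.
have b0 : 0 <= a * t `^ p by rewrite mulr_ge0 ?powR_ge0 ?ltW.
have q0 : 0 <= p^-1 by rewrite invr_ge0 ltW.
have := ge0_ler_powR q0 b0 (le_trans b0 h) h.
rewrite (powRM _ (ltW a0) (powR_ge0 _ _)) -powRrM divff ?(gt_eqF p0) //.
rewrite (powRr1 (ltW t0)) => h2.
by rewrite powRN ler_pdivlMr ?powR_gt0 // mulrC.
Qed.

(** For p <= 1 the quotient of [t] by the threshold value is also controlled by
    [a `^ (- p^-1)]: it equals a^-1 t^(1 - p), where the exponent of [t] is
    nonnegative, so the bound of [threshold_size] may be raised to that power. *)
Lemma threshold_ratio a c p t : 0 < a -> 0 < p <= 1 -> 0 < t ->
  a * t `^ p < c -> t / (a * t `^ p) <= c `^ (p^-1 * (1 - p)) * a `^ (- p^-1).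
Proof.
move=> a0 /andP[p0 p1] t0 h.
have c0 : 0 <= c by rewrite (le_trans _ (ltW h)) // mulr_ge0 ?powR_ge0 ?ltW.
have q0 : 0 <= 1 - p by rewrite subr_ge0.
have e1 : t / (a * t `^ p) = a^-1 * t `^ (1 - p).
  rewrite powRB ?(gt_eqF t0) ?implybT // powRr1 ?ltW // invfM.
  by rewrite mulrCA.
have e2 : a `^ (- p^-1) = a^-1 * a `^ (- p^-1 * (1 - p)).
  rewrite -(powR_inv1 (ltW a0)) -powRD ?(gt_eqF a0) ?implybT //.
  by congr (_ `^ _); field; rewrite gt_eqF.
rewrite e1 e2 [leRHS]mulrCA ler_pM2l ?invr_gt0 //.
have := ge0_ler_powR q0 (ltW t0) _ (threshold_size a0 p0 t0 h).
rewrite nnegrE mulr_ge0 ?powR_ge0 // powRM ?powR_ge0 // -!powRrM.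
by apply.
Qed.

Lemma sqr_le_mul_bound (t v D : R) : 0 <= t -> 0 <= v -> 0 <= D ->
  t ^+ 2 <= v * D -> t <= v + D.
Proof. by move=> t0 v0 D0 h; rewrite -ler_sqr ?nnegrE ?addr_ge0 //; nra. Qed.

End Thresholds.

(** * Line search *)

Section StepSize.
Context {R : realType} {n : nat}.
Variables (f : 'cV[R]_n -> R) (rho sigma s M : R) (B : 'M[R]_n).
Variables (x d : 'cV[R]_n) (lambda : R).
Hypothesis rho_range : 0 < rho < 1.
Hypothesis sigma_gt0 : 0 < sigma.
Hypothesis s_gt0 : 0 < s.
Hypothesis M_ge0 : 0 <= M.
Hypothesis B_bounded : spectral_norm B <= M.
Let rho_gt0 : 0 < rho. Proof. by case/andP: rho_range. Qed.
Let rho_le1 : rho <= 1. Proof. by case/andP: rho_range => _ /ltW. Qed.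

Lemma step_size_gt0 fl : step_size f rho sigma s B x d fl lambda -> 0 < lambda.
Proof.
case: fl => /=; [|case=> h1 h2|]; [by case=> j _ ->; rewrite mulr_gt0 ?exprn_gt0| |].
  have [Cs|nCs] := pselect (curvature_decrease f sigma B x d s).
    by have [j _ ->] := h2 Cs; rewrite mulr_gt0 ?invr_gt0 ?exprn_gt0.
  by have [j _ ->] := h1 nCs; rewrite mulr_gt0 ?exprn_gt0.
by case=> j _ ->; rewrite mulr_gt0 ?exprn_gt0.
Qed.

Lemma step_size_armijo fl : fl <> NPC ->
  step_size f rho sigma s B x d fl lambda ->
  lambda <= s /\ armijo f sigma x d lambda.
Proof.
have le_s j : s * rho ^+ j <= s by rewrite ler_piMr ?(ltW s_gt0) // exprn_ile1 // ltW.
by case: fl => //= _ [j [Pj _] ->].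
Qed.

Lemma step_size_curvature : step_size f rho sigma s B x d NPC lambda ->
  curvature_decrease f sigma B x d lambda.
Proof.
move=> [h1 h2]; have [Cs|nCs] := pselect (curvature_decrease f sigma B x d s).
  by have [j [Pj _] ->] := h2 Cs; exact: Pj.
by have [j [[_ Pj] _] ->] := h1 nCs.
Qed.

(** A step size below [s] is the result of backtracking, and the preceding trial
    step was rejected. As the curvature along [d] is at least - M |d|^2, the
    failures of both acceptance tests imply the same inequality. *)
Lemma step_size_backtracked fl : step_size f rho sigma s B x d fl lambda ->
  lambda < s ->
  sigma * (lambda / rho) * dot (grad f x) d -
    sigma / 2 * (lambda / rho) ^+ 2 * (M * enorm d ^+ 2) <
  f (x + (lambda / rho) *: d) - f x.
Proof.
have M_ge : - (M * enorm d ^+ 2) <= dot d (B *m d).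
  rewrite lerNl -dotNl; apply: le_trans (dot_le_enorm _ _) _.
  rewrite enormN expr2 mulrA mulrC ler_wpM2r ?enorm_ge0 //.
  apply: le_trans (spectral_norm_bound _ _) _.
  by rewrite ler_wpM2r ?enorm_ge0.
have Md_ge0 : 0 <= M * enorm d ^+ 2 by rewrite mulr_ge0 ?sqr_ge0.
have fail_armijo mu : ~ armijo f sigma x d mu ->
    sigma * mu * dot (grad f x) d - sigma / 2 * mu ^+ 2 * (M * enorm d ^+ 2)
    < f (x + mu *: d) - f x.
  move/negP; rewrite -ltNge (dotC d); apply: le_lt_trans.
  by rewrite gerBl mulr_ge0 // mulr_ge0 ?sqr_ge0 // divr_ge0 ?(ltW sigma_gt0).
have fail_curv mu : ~ curvature_decrease f sigma B x d mu ->
    sigma * mu * dot (grad f x) d - sigma / 2 * mu ^+ 2 * (M * enorm d ^+ 2)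
    < f (x + mu *: d) - f x.
  move/negP; rewrite -ltNge; apply: le_lt_trans; rewrite lerD2l -mulrN.
  by rewrite ler_wpM2l // mulr_ge0 ?sqr_ge0 // divr_ge0 ?(ltW sigma_gt0).
have pred_step j : s * rho ^+ j.+1 / rho = s * rho ^+ j.
  by rewrite exprSr mulrA mulfK // gt_eqF.
case: fl => /=.
- case=> -[|j] [Pj jmin] ->; rewrite ?expr0 ?mulr1 ?ltxx // => _.
  by rewrite pred_step; apply: fail_armijo => /jmin; rewrite ltnn.
- case=> h1 h2; have [Cs|nCs] := pselect (curvature_decrease f sigma B x d s).
    have [j _ ->] := h2 Cs.
    rewrite gtr_pMr // ltNge => /negP[].
    by rewrite invf_ge1 ?exprn_gt0 // exprn_ile1 // ltW.
  have [[|j] [[//]] _ Pj jmin -> _] := h1 nCs.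
  rewrite pred_step; apply: fail_curv.
  case: j jmin {Pj} => [|j] jmin; first by rewrite expr0 mulr1.
  by move=> Cj; have := jmin j.+1 (conj isT Cj); rewrite ltnn.
- case=> -[|j] [Pj jmin] ->; rewrite ?expr0 ?mulr1 ?ltxx // => _.
  by rewrite pred_step; apply: fail_armijo => /jmin; rewrite ltnn.
Qed.

End StepSize.

(** * Estimates for a single iteration *)

Section IterationEstimates.
Context {R : realType} {n : nat}.
Variables (f : 'cV[R]_n -> R) (rho sigma alpha Acap s M Bcap beta Zcap zexp : R).
Hypothesis rho_range : 0 < rho < 1.
Hypothesis sigma_gt0 : 0 < sigma.
Hypothesis alpha_range : 0 < alpha <= 1.
Hypothesis Acap_gt0 : 0 < Acap.
Hypothesis s_gt0 : 0 < s.
Hypothesis M_gt0 : 0 < M.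
Hypothesis Bcap_gt0 : 0 < Bcap.
Hypothesis beta_gt0 : 0 < beta.
Hypothesis Zcap_gt0 : 0 < Zcap.
Hypothesis zexp_range : 0 < zexp <= 1.

Let L := M + Zcap.
Let L_gt0 : 0 < L. Proof. exact: addr_gt0. Qed.

(** Lower bound of |d| / |g| for directions computed with theta and tau equal to
    their caps: 1 serves the NPC and GD directions, and the two branches are the
    two lower bounds of [direction_SOL]. *)
Definition length_constant : R :=
  Num.min 1 (if Bcap < 1 then (1 - Bcap) / L else Acap / L ^+ 2).

(** Lower bound of the cosine of the angle between [d] and [- g] for directions
    computed with theta and tau equal to their caps: the first term serves
    the SOL directions, the second one the NPC and GD directions. *)
Definition angle_constant : R :=
  Num.min (Acap * length_constant) (Num.min 1 Bcap).

Lemma length_constant_gt0 : 0 < length_constant.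
Proof.
rewrite /length_constant lt_min ltr01 /=; case: ifP => [B1|_].
  by rewrite divr_gt0 ?subr_gt0.
by rewrite divr_gt0 ?exprn_gt0.
Qed.

Lemma angle_constant_gt0 : 0 < angle_constant.
Proof. by rewrite !lt_min ltr01 Bcap_gt0 mulr_gt0 // length_constant_gt0. Qed.

Lemma shifted_bound (B : 'M[R]_n) zeta v : spectral_norm B <= M ->
  0 <= zeta <= Zcap -> enorm ((B + zeta%:M) *m v) <= L * enorm v.
Proof.
move=> BM /andP[z0 zZ]; rewrite mulmxDl mul_scalar_mx.
apply: le_trans (ler_enormD _ _) _; rewrite enormZ ger0_norm // /L mulrDl.
rewrite lerD ?ler_wpM2r ?enorm_ge0 //.
apply: le_trans (spectral_norm_bound _ _) _.
by rewrite ler_wpM2r ?enorm_ge0.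
Qed.

Lemma direction_angle_length (A : 'M[R]_n) g tau d fl : A^T = A ->
  (forall v, enorm (A *m v) <= L * enorm v) -> g <> 0 ->
  direction A g Bcap tau d fl -> Acap <= tau ->
  length_constant * enorm g <= enorm d /\
  angle_constant * enorm g * enorm d <= - dot g d.
Proof.
move=> As AL g0 dir Atau; have g_gt0 := enorm_gt0 g0.
have kap0 := length_constant_gt0.
have tau0 : 0 < tau by exact: lt_le_trans Atau.
have kap1 : length_constant <= 1 by rewrite ge_min lexx.
have nuB : angle_constant <= Num.min 1 Bcap by rewrite ge_min lexx orbT.
have nu1 : angle_constant <= 1 by rewrite (le_trans nuB) // ge_min lexx.
have nuA : angle_constant <= Acap * length_constant by rewrite ge_min lexx.
case: fl dir => dir.
- have [d0 desc _ len1 len2] := direction_SOL As AL g0 dir.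
  have len : length_constant * enorm g <= enorm d.
    have : length_constant <= if Bcap < 1 then (1 - Bcap) / L else Acap / L ^+ 2.
      by rewrite ge_min lexx orbT.
    move: len1 len2; case: ltP => B1 len1 len2 kapE.
      apply: le_trans (_ : (1 - Bcap) / L * enorm g <= _).
        by rewrite ler_wpM2r ?enorm_ge0.
      by rewrite mulrAC ler_pdivrMr // [leRHS]mulrC.
    apply: le_trans (_ : Acap / L ^+ 2 * enorm g <= _).
      by rewrite ler_wpM2r ?enorm_ge0.
    rewrite mulrAC ler_pdivrMr ?exprn_gt0 // [leRHS]mulrC.
    by apply: le_trans (len2 isT); rewrite ler_wpM2r ?enorm_ge0.
  split=> //; apply: le_trans desc.
  rewrite expr2 mulrA ler_wpM2r ?enorm_ge0 //.
  apply: le_trans (_ : Acap * (length_constant * enorm g) <= _).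
    by rewrite mulrA ler_wpM2r ?enorm_ge0.
  by rewrite ler_pM ?mulr_ge0 ?enorm_ge0 ?(ltW kap0) ?(ltW Acap_gt0).
- have [-> _ desc] := direction_NPC g0 (ltW Bcap_gt0) dir.
  split; first by rewrite ler_piMl ?enorm_ge0.
  by apply: le_trans desc; rewrite -mulrA -expr2 ler_wpM2r ?sqr_ge0.
- rewrite (direction_GD dir) enormN dotNr opprK -enorm_sqr.
  split; first by rewrite ler_piMl ?enorm_ge0.
  by rewrite -mulrA -expr2 ler_piMl ?sqr_ge0.
Qed.

Section OneIteration.
Variables (a b z : R) (B : 'M[R]_n) (x d : 'cV[R]_n) (fl : flag) (lambda : R).
Let g := grad f x.
Let theta := Num.min Bcap (b * enorm g `^ beta).
Let tau := Num.min Acap (a * enorm g `^ alpha).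
Let zeta := Num.min Zcap (z * enorm g `^ zexp).
Hypothesis a_gt0 : 0 < a.
Hypothesis b_gt0 : 0 < b.
Hypothesis z_gt0 : 0 < z.
Hypothesis B_sym : B^T = B.
Hypothesis B_bounded : spectral_norm B <= M.
Hypothesis g_neq0 : g <> 0.
Hypothesis d_direction : direction (B + zeta%:M) g theta tau d fl.
Hypothesis lambda_step : step_size f rho sigma s B x d fl lambda.

Let g_gt0 : 0 < enorm g. Proof. exact: enorm_gt0. Qed.
Let theta_gt0 : 0 < theta.
Proof. by rewrite lt_min Bcap_gt0 mulr_gt0 ?powR_gt0. Qed.
Let tau_gt0 : 0 < tau.
Proof. by rewrite lt_min Acap_gt0 mulr_gt0 ?powR_gt0. Qed.
Let zeta_gt0 : 0 < zeta.
Proof. by rewrite lt_min Zcap_gt0 mulr_gt0 ?powR_gt0. Qed.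
Let zeta_le : zeta <= Zcap. Proof. by rewrite ge_min lexx. Qed.
Let Bbar_sym : (B + zeta%:M)^T = B + zeta%:M.
Proof. by rewrite linearD /= B_sym tr_scalar_mx. Qed.
Let Bbar_bound v : enorm ((B + zeta%:M) *m v) <= L * enorm v.
Proof. by rewrite shifted_bound // (ltW zeta_gt0). Qed.
Let lambda_gt0 : 0 < lambda.
Proof. exact: step_size_gt0 lambda_step. Qed.

Lemma descent_direction : 0 < - dot g d.
Proof.
case: fl d_direction => dir.
- have [d0 h _ _ _] := direction_SOL Bbar_sym Bbar_bound g_neq0 dir.
  by apply: lt_le_trans h; rewrite mulr_gt0 ?exprn_gt0.
- have [_ _ h] := direction_NPC g_neq0 (ltW theta_gt0) dir.
  by apply: lt_le_trans h; rewrite mulr_gt0 ?exprn_gt0 // lt_min ltr01.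
- by rewrite (direction_GD dir) dotNr opprK -enorm_sqr exprn_gt0.
Qed.

(** For NPC directions the acceptance test contains the curvature of [B] along
    [d], which is nonpositive since that of the shifted matrix is. *)
Lemma decrease_slope : sigma * lambda * - dot g d <= f x - f (x + lambda *: d).
Proof.
case: fl d_direction lambda_step => dir step.
- have nNPC : SOL <> NPC by [].
  have [_] := step_size_armijo rho_range s_gt0 nNPC step.
  by rewrite /armijo -/g dotC; lra.
- have := step_size_curvature step.
  have [_ curv _] := direction_NPC g_neq0 (ltW theta_gt0) dir.
  have dBd : dot d (B *m d) <= 0.
    move: curv; rewrite mulmxDl mul_scalar_mx dotDr dotZr -enorm_sqr.
    by have := mulr_ge0 (ltW zeta_gt0) (sqr_ge0 (enorm d)); lra.
  rewrite /curvature_decrease -/g => h.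
  have : sigma / 2 * lambda ^+ 2 * dot d (B *m d) <= 0.
    by rewrite mulr_ge0_le0 // mulr_ge0 ?sqr_ge0 // divr_ge0 // ltW.
  by move: h; lra.
- have nNPC : GD <> NPC by [].
  have [_] := step_size_armijo rho_range s_gt0 nNPC step.
  by rewrite /armijo -/g dotC; lra.
Qed.

(** Nonpositive curvature of the shifted matrix means d . B d <= - zeta |d|^2.
    This is what controls the forward steps, whose size has no upper bound. *)
Lemma decrease_curvature : fl = NPC ->
  sigma / 2 * zeta * enorm (lambda *: d) ^+ 2 <= f x - f (x + lambda *: d).
Proof.
move=> flE; move: d_direction lambda_step; rewrite flE => dir step.
have := step_size_curvature step.
have [_ curv _] := direction_NPC g_neq0 (ltW theta_gt0) dir.
have slope := descent_direction.
rewrite /curvature_decrease -/g enormZ gtr0_norm // exprMn => h.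
have : sigma * lambda * dot g d <= 0.
  by rewrite pmulr_rle0 ?mulr_gt0 // -oppr_ge0 ltW.
have : sigma / 2 * lambda ^+ 2 * (zeta * enorm d ^+ 2 + dot d (B *m d)) <= 0.
  rewrite mulr_ge0_le0 //; first by rewrite mulr_ge0 ?sqr_ge0 // divr_ge0 // ltW.
  by move: curv; rewrite mulmxDl mul_scalar_mx dotDr dotZr -enorm_sqr addrC.
by move: h; lra.
Qed.

Let K_theta := Bcap `^ beta^-1.
Let K_zeta := Zcap `^ (zexp^-1 * (1 - zexp)).
Let K_tau := Acap `^ (alpha^-1 * (1 - alpha)).

(** One summand for each case of [step_length_bound]; the last one comes from
    the inequality of the means. *)
Definition step_constant : R :=
  s * K_tau + s / Acap * K_theta + (sigma * angle_constant)^-1 +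
  2 / (sigma * Zcap) * K_theta + 2 / sigma * K_zeta + 1.

(** If both tau and theta are at their caps, the angle condition gives a multiple
    of [D]. If tau is not, a SOL direction has length at most |g| / tau, which is
    controlled by [threshold_ratio]. If theta is not, |g| is small by
    [threshold_size]; this settles SOL directions, and for NPC directions
    [decrease_curvature] bounds the squared step by |g| D / zeta, where
    either zeta is at its cap and |g| is small, or |g| / zeta is small. *)
Lemma step_length_bound D :
  f x - f (x + lambda *: d) <= enorm g * D ->
  enorm (lambda *: d) <= step_constant *
    (D + (a `^ (- alpha^-1) + b `^ (- beta^-1) + z `^ (- zexp^-1))).
Proof.
move=> decD.
have [alpha0 _] := andP alpha_range; have [zexp0 _] := andP zexp_range.
have slope := descent_direction.
have decS := decrease_slope.
have D0 : 0 <= D.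
  rewrite -(pmulr_rge0 _ g_gt0); apply: le_trans decD; apply: le_trans decS.
  by rewrite ltW // !mulr_gt0.
set u := a `^ _; set v := b `^ _; set y := z `^ _.
have u0 : 0 <= u by exact: powR_ge0.
have v0 : 0 <= v by exact: powR_ge0.
have y0 : 0 <= y by exact: powR_ge0.
have Kt0 : 0 <= K_tau by exact: powR_ge0.
have Kth0 : 0 <= K_theta by exact: powR_ge0.
have Kz0 : 0 <= K_zeta by exact: powR_ge0.
have nu0 := angle_constant_gt0.
set C1 := s * K_tau; set C2 := s / Acap * K_theta.
set C3 := (sigma * angle_constant)^-1.
set C4 := 2 / (sigma * Zcap) * K_theta; set C5 := 2 / sigma * K_zeta.
have C10 : 0 <= C1 by rewrite mulr_ge0 // ltW.
have C20 : 0 <= C2 by rewrite mulr_ge0 // divr_ge0 // ltW.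
have C30 : 0 <= C3 by rewrite invr_ge0 ltW // mulr_gt0.
have C40 : 0 <= C4 by rewrite mulr_ge0 // divr_ge0 // ltW // mulr_gt0.
have C50 : 0 <= C5 by rewrite mulr_ge0 // divr_ge0 // ltW.
suff : [\/ enorm (lambda *: d) <= C1 * u, enorm (lambda *: d) <= C2 * v,
  enorm (lambda *: d) <= C3 * D
  | enorm (lambda *: d) <= C4 * v + C5 * y + D].
  rewrite /step_constant -/C1 -/C2 -/C3 -/C4 -/C5.
  set T := D + (u + v + y).
  have uT : u <= T by rewrite /T; lra.
  have vT : v <= T by rewrite /T; lra.
  have yT : y <= T by rewrite /T; lra.
  have DT : D <= T by rewrite /T; lra.
  have le_sum c t : 0 <= c -> c <= C1 + C2 + C3 + C4 + C5 + 1 -> 0 <= t ->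
      t <= T -> c * t <= (C1 + C2 + C3 + C4 + C5 + 1) * T by move=> *; exact: ler_pM.
  case=> h; apply: le_trans h _; [by apply: le_sum => //; lra..|].
  apply: le_trans (_ : (C4 + C5 + 1) * T <= _); last by apply: le_sum; lra.
  by rewrite !mulrDl mul1r !lerD // ler_wpM2l.
have angle : angle_constant * enorm g * enorm d <= - dot g d ->
    enorm (lambda *: d) <= C3 * D.
  move=> h; rewrite /C3 mulrC ler_pdivlMr ?mulr_gt0 // -(ler_pM2l g_gt0).
  apply: le_trans decD; apply: le_trans decS.
  rewrite enormZ gtr0_norm //.
  rewrite -(ler_pM2l (mulr_gt0 sigma_gt0 lambda_gt0)) in h.
  by apply: le_trans h; rewrite le_eqVlt; apply/orP; left; apply/eqP; ring.
have theta_small : b * enorm g `^ beta < Bcap -> enorm g <= K_theta * v.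
  exact: threshold_size.
have thetaE : Bcap <= b * enorm g `^ beta -> theta = Bcap by move/min_idPl.
have short : fl <> NPC -> enorm (lambda *: d) <= s * enorm d.
  move=> flE; rewrite enormZ gtr0_norm // ler_wpM2r ?enorm_ge0 //.
  by have [] := step_size_armijo rho_range s_gt0 flE lambda_step.
have curved := decrease_curvature.
have [nuA nuB] : angle_constant <= 1 /\ angle_constant <= Bcap.
  have : angle_constant <= Num.min 1 Bcap by rewrite ge_min lexx orbT.
  by rewrite le_min => /andP.
case: (fl) (d_direction) short curved => dir short curved.
- have nNPC : SOL <> NPC by [].
  have {short} := short nNPC.
  have [_ _ dg _ _] := direction_SOL Bbar_sym Bbar_bound g_neq0 dir.
  move=> short; have [good_tau|bad_tau] := lerP Acap (a * enorm g `^ alpha); last first.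
    constructor 1; apply: le_trans short _; rewrite -mulrA ler_pM2l //.
    have := threshold_ratio a_gt0 alpha_range g_gt0 bad_tau; apply: le_trans.
    have tauE : tau = a * enorm g `^ alpha by apply/min_idPr/ltW.
    by rewrite -tauE ler_pdivlMr // mulrC.
  have tauE : tau = Acap by apply/min_idPl.
  have [good_theta|/theta_small bad_theta] := lerP Bcap (b * enorm g `^ beta).
    constructor 3; apply: angle; rewrite thetaE // in dir.
    have tauA : Acap <= tau by rewrite tauE.
    by have [] := direction_angle_length Bbar_sym Bbar_bound g_neq0 dir tauA.
  constructor 2; apply: le_trans short _; rewrite /C2 -!mulrA ler_pM2l //.
  rewrite -ler_pdivrMl ?invr_gt0 // invrK -tauE.
  exact: le_trans dg bad_theta.
- have {curved} := curved erefl.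
  have [dE _ desc] := direction_NPC g_neq0 (ltW theta_gt0) dir.
  have [good_theta|/theta_small bad_theta] := lerP Bcap (b * enorm g `^ beta).
    move=> _; constructor 3; apply: angle; rewrite dE.
    apply: le_trans desc; rewrite thetaE // -mulrA -expr2 ler_wpM2r ?sqr_ge0 //.
    by rewrite le_min nuA.
  have t0 := enorm_ge0 (lambda *: d).
  move=> /le_trans /(_ decD) step2.
  have [good_zeta|bad_zeta] := lerP Zcap (z * enorm g `^ zexp).
    have zetaZ : zeta = Zcap by apply/min_idPl.
    constructor 4; apply: le_trans (_ : C4 * v + D <= _); last first.
      by rewrite lerD2r lerDl mulr_ge0.
    apply: sqr_le_mul_bound => //; first exact: mulr_ge0.
    have sz : 0 < sigma / 2 * Zcap by rewrite !mulr_gt0.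
    rewrite -(ler_pM2l sz); rewrite zetaZ in step2; apply: le_trans step2 _.
    have -> : sigma / 2 * Zcap * (C4 * v * D) = K_theta * v * D.
      by rewrite /C4; field; rewrite !gt_eqF.
    by rewrite ler_wpM2r.
  have zetaz : zeta = z * enorm g `^ zexp by apply/min_idPr/ltW.
  constructor 4; apply: le_trans (_ : C5 * y + D <= _); last first.
    by rewrite lerD2r lerDr mulr_ge0.
  apply: sqr_le_mul_bound => //; first exact: mulr_ge0.
  have := threshold_ratio z_gt0 zexp_range g_gt0 bad_zeta.
  rewrite -zetaz -/K_zeta -/y => ratio.
  have s2 : 0 < sigma / 2 by rewrite divr_gt0.
  rewrite -(ler_pM2l s2).
  have -> : sigma / 2 * (C5 * y * D) = K_zeta * y * D.
    by rewrite /C5; field; rewrite gt_eqF.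
  apply: le_trans (ler_wpM2r D0 ratio).
  rewrite [leRHS]mulrAC ler_pdivlMr //; apply: le_trans step2.
  by rewrite le_eqVlt; apply/orP; left; apply/eqP; ring.
- constructor 3; apply: angle; rewrite (direction_GD dir) enormN dotNr opprK.
  by rewrite -enorm_sqr -mulrA -expr2 ler_piMl ?sqr_ge0.
Qed.

Lemma step_constant_gt0 : 0 < step_constant.
Proof.
have nu0 := angle_constant_gt0.
by rewrite ltr_wpDl // ?ltr01 // !addr_ge0 ?mulr_ge0 ?divr_ge0 ?invr_ge0
  ?powR_ge0 // ?mulr_ge0 ?ltW.
Qed.

Lemma angle_length : Acap <= a * enorm g `^ alpha ->
  Bcap <= b * enorm g `^ beta ->
  length_constant * enorm g <= enorm d /\
  angle_constant * enorm g * enorm d <= - dot g d.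
Proof.
move=> good_tau good_theta; have thetaE : theta = Bcap by apply/min_idPl.
have tauA : Acap <= tau by rewrite le_min lexx.
have dir := d_direction; rewrite thetaE in dir.
exact: direction_angle_length Bbar_sym Bbar_bound g_neq0 dir tauA.
Qed.

End OneIteration.

End IterationEstimates.

(** * Summable sequences and lower limits *)

Section Sequences.
Context {R : realType}.

(** The Cauchy criterion for a series of nonnegative terms: the form in which
    summability enters the trapping argument. *)
Definition small_tails (e : nat -> R) := forall eps, 0 < eps ->
  exists K, forall i j, (K <= i <= j)%N -> \sum_(i <= k < j) e k < eps.

Lemma small_tailsD e1 e2 : small_tails e1 -> small_tails e2 ->
  small_tails (fun k => e1 k + e2 k).
Proof.
move=> t1 t2 eps eps0; have e20 : 0 < eps / 2 by rewrite divr_gt0.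
have [K1 h1] := t1 _ e20; have [K2 h2] := t2 _ e20.
exists (maxn K1 K2) => i j; rewrite geq_max => /andP[/andP[i1 i2] ij].
by rewrite big_split /= (splitr eps) ltrD // ?h1 ?h2 ?i1 ?i2 ?ij.
Qed.

Lemma small_tailsZ c e : 0 < c -> small_tails e -> small_tails (fun k => c * e k).
Proof.
move=> c0 t eps eps0; have [|K h] := t (eps / c); first by rewrite divr_gt0.
exists K => i j Kij; rewrite -mulr_sumr mulrC -ltr_pdivlMr //; exact: h.
Qed.

Lemma small_tails_terms e : small_tails e ->
  forall eps, 0 < eps -> exists K, forall k, (K <= k)%N -> e k < eps.
Proof.
move=> t eps /t[K h]; exists K => k Kk.
by have := h k k.+1; rewrite Kk leqnSn big_nat1; apply.
Qed.

Lemma summable_small_tails (u : nat -> R) : (forall k, 0 <= u k) ->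
  (\sum_(1 <= k <oo) (u k)%:E < +oo)%E -> small_tails u.
Proof.
move=> u0 usum eps eps0.
pose P j := \sum_(1 <= k < j) u k.
have Psup : has_sup (range P).
  split; first by exists (P 0%N), 0%N.
  exists (fine (\sum_(1 <= k <oo) (u k)%:E)) => _ [j _ <-].
  rewrite -lee_fin fineK; last first.
    by rewrite ge0_fin_numE // nneseries_ge0 // => k _ _; rewrite lee_fin.
  rewrite /P -sumEFin; apply: nneseries_lim_ge => k _ _.
  by rewrite lee_fin.
have [_ [K _ <-] PK] := sup_adherent eps0 Psup.
exists (maxn 1 K) => i j; rewrite geq_max => /andP[/andP[i1 Ki] ij].
have Pj : P j <= sup (range P) by apply: ub_le_sup; [case: Psup|exists j].
have PKi : P K <= P i.
  have [K1|K1] := leqP 1 K; last first.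
    by rewrite /P big_geq ?(ltnW K1) // sumr_ge0.
  by rewrite /P (big_cat_nat K1 Ki) //= lerDl sumr_ge0.
have : P j = P i + \sum_(i <= k < j) u k by rewrite /P (big_cat_nat i1 ij).
by lra.
Qed.

Lemma limn_einf0_frequently (u : nat -> R) : limn_einf (EFin \o u) = 0%E ->
  forall eps K, 0 < eps -> exists2 k, (K <= k)%N & u k < eps.
Proof.
move=> u0 eps K eps0.
have : (einfs (EFin \o u) K < eps%:E)%E.
  apply: le_lt_trans (_ : (0 < eps%:E)%E); last by rewrite lte_fin.
  rewrite -u0 limn_einf_lim.
  have /cvg_lim -> // := ereal_nondecreasing_cvgn (nondecreasing_einfs (EFin \o u)).
  by apply: ereal_sup_ubound; exists K.
by move=> /ereal_inf_lt[_ [k /= Kk <-]]; rewrite lte_fin; exists k.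
Qed.

End Sequences.

(** * Desingularizing functions *)

Section Desingularizing.
Context {R : realType}.
Variables (eta : \bar R) (phi : R -> R).
Hypothesis phi_des : desingularizing eta phi.

(** A concave function lies below its tangent. The left difference quotients
    at [u] with increments h in [v - u, 0[ are at most the slope of the chord
    over [v, u], and this passes to the limit. *)
Lemma desingularizing_gap u v : 0 < u -> (u%:E < eta)%E -> 0 <= v < u ->
  derive1 phi u * (u - v) <= phi u - phi v.
Proof.
move=> u0 ueta /andP[v0 vu]; have [_ _ cvx drv _] := phi_des.
have veta : (v%:E < eta)%E by apply: lt_trans ueta; rewrite lte_fin.
rewrite -ler_pdivlMr ?subr_gt0 // derive1E.
have [der _] := drv u (conj u0 ueta).
have uv0 : 0 < u - v by rewrite subr_gt0.
have := cvg_dnbhs_at_left der; rewrite -/(derive phi u 1) => cl.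
rewrite -(cvg_lim _ cl) //.
apply: limr_le; first by apply/cvg_ex; eexists; exact: cl.
near=> h.
have h0 : h < 0 by near: h; exact: nbhs_left_lt.
have hv : v - u < h.
  by near: h; apply: nbhs_left_gt; rewrite subr_lt0.
have t0 : 0 <= - h / (u - v) by rewrite divr_ge0 ?oppr_ge0 ?ltW.
have t1 : - h / (u - v) <= 1 by rewrite ler_pdivrMr // mul1r; lra.
have := @cvx (Itv01 t0 t1) v u.
rewrite !inE /= => /(_ (conj v0 veta) (conj (ltW u0) ueta)).
set w := (X in - phi X <= _); have -> : w = h + u :> R.
  rewrite -[LHS]/(- h / (u - v) * v + (1 - - h / (u - v)) * u).
  by field; rewrite gt_eqF.
rewrite -[leRHS]/(- h / (u - v) * - phi v + (1 - - h / (u - v)) * - phi u).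
rewrite [h%:A]mulr1 => cv.
rewrite -[leLHS]/(h^-1 * (phi (h + u) - phi u)).
rewrite -(ler_nM2l h0) mulVKf ?lt_eqF //.
have -> : h * ((phi u - phi v) / (u - v)) = - h / (u - v) * (phi v - phi u).
  by field; rewrite gt_eqF.
by move: cv; lra.
Unshelve. all: by end_near.
Qed.

Lemma desingularizing_small eps : (0 < eta)%E -> 0 < eps ->
  exists2 del, 0 < del &
    forall t, 0 <= t < del -> (t%:E < eta)%E /\ phi t < eps.
Proof.
move=> eta0 eps0; have [cont _ _ _ [phi0 _]] := phi_des.
have [c c0 ceta] : exists2 c, 0 < c & (c%:E <= eta)%E.
  case: (eta) eta0 => [r| |] //; first by rewrite lte_fin; exists r.
  by move=> _; exists 1; rewrite ?ltr01 ?leey.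
have /subspace_continuousP := cont.
move=> /(_ 0 (conj (lexx _) eta0)) /cvgrPdist_lt /(_ _ eps0).
rewrite /within /= => /nbhs_normP[r /= r0 hr].
exists (Num.min c r) => [|t /andP[t0]]; first by rewrite lt_min c0.
rewrite lt_min => /andP[tc tr].
have teta : (t%:E < eta)%E by apply: lt_le_trans ceta; rewrite lte_fin.
split=> //; have := hr t; rewrite /from_subspace /= sub0r normrN ger0_norm // phi0 sub0r normrN.
by move=> /(_ tr (conj t0 teta)); apply: le_lt_trans; exact: ler_norm.
Qed.

End Desingularizing.

(** * The mean value theorem along a line *)

Section LineMVT.
Context {R : realType} {n : nat}.
Variable f : 'cV[R]_n -> R.
Hypothesis f_diff : forall x, differentiable f x.

Lemma derive_grad x v : 'D_v f x = dot (grad f x) v.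
Proof.
rewrite deriveE // {1}[v]matrix_sum_delta linear_sum dotE; apply: eq_bigr => i _.
by rewrite big_ord1 linearZ /= mxE deriveE // mulrC.
Qed.

Lemma line_MVT x d mu : 0 <= mu -> exists2 c, 0 <= c <= mu &
  f (x + mu *: d) - f x = mu * dot (grad f (x + c *: d)) d.
Proof.
move=> mu0; pose phi t := f (x + t *: d).
have phiD (t : R) : is_derive t 1 phi (dot (grad f (x + t *: d)) d).
  have E : (fun h : R => h^-1 *: ((phi \o shift t) (h *: 1) - phi t)) =
           (fun h : R => h^-1 *: ((f \o shift (x + t *: d)) (h *: d) - f (x + t *: d))).
    apply/funext => h; rewrite /= /phi; congr (_ *: (f _ - _)).
    by rewrite scalerDl addrCA [h *: 1]mulr1.
  apply: DeriveDef; first by rewrite /derivable E; apply: diff_derivable.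
  by rewrite /derive E -derive_grad.
have phi_cont : {within `[0, mu], continuous phi}.
  apply: continuous_subspaceT => t; apply/differentiable_continuous/derivable1_diffP.
  exact: ex_derive.
have [c] := MVT_segment mu0 (fun t _ => phiD t) phi_cont.
rewrite in_itv /= => cmu; rewrite /phi scale0r addr0 subr0 mulrC => h.
by exists c.
Qed.

End LineMVT.

(** * Trapping near an accumulation point *)

Section Trapping.
Context {R : realType} {n : nat}.

(** Starting from a late index at which [x] is close to [xs], the steps add up
    to at most the telescoping sum of the decrements of [C * Phi] plus a tail of
    [e], hence to less than the distance that remains to the boundary of the
    ball; so the step bound keeps applying. *)
Lemma trapped_converges (x : nat -> 'cV[R]_n) xs (r C : R)
    (Phi e : nat -> R) K0 :
  0 < r -> 0 < C -> (forall k, 0 <= Phi k) ->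
  (forall eps, 0 < eps -> exists K, forall k, (K <= k)%N -> Phi k < eps) ->
  small_tails e ->
  (forall eps K, 0 < eps -> exists2 k, (K <= k)%N & enorm (x k - xs) < eps) ->
  (forall k, (K0 <= k)%N -> enorm (x k - xs) < r ->
     enorm (x k.+1 - x k) <= C * (Phi k - Phi k.+1) + e k) ->
  forall eps, 0 < eps -> exists K, forall k, (K <= k)%N -> enorm (x k - xs) < eps.
Proof.
move=> r0 C0 Phi0 Philim etail acc step eps eps0.
pose ep := Num.min eps r.
have ep0 : 0 < ep by rewrite lt_min eps0.
have e3 : 0 < ep / 3 by rewrite divr_gt0.
(* The start, the telescoping sum and the tail get one third of the radius each. *)
have [K1 hPhi] := Philim (ep / 3 / C) (divr_gt0 e3 C0).
have [K2 he] := etail _ e3.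
have [K KK hK] := acc _ (maxn K0 (maxn K1 K2)) e3.
move: KK; rewrite !geq_max => /and3P[KK0 KK1 KK2].
have CPhi : C * Phi K < ep / 3 by rewrite mulrC -ltr_pdivlMr // hPhi.
have close j : (K <= j)%N ->
    enorm (x j - xs) <= enorm (x K - xs) + C * (Phi K - Phi j) + \sum_(K <= i < j) e i ->
    enorm (x j - xs) < ep.
  move=> Kj; have := he K j; rewrite KK2 Kj => /(_ isT).
  have := mulr_ge0 (ltW C0) (Phi0 j); lra.
have bound j : (K <= j)%N ->
    enorm (x j - xs) <= enorm (x K - xs) + C * (Phi K - Phi j) + \sum_(K <= i < j) e i.
  elim: j => [|j IH].
    by rewrite leqn0 => /eqP ->; rewrite subrr mulr0 addr0 big_geq // addr0.
  rewrite leq_eqVlt => /orP[/eqP <-|]; first by rewrite subrr mulr0 addr0 big_geq // addr0.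
  rewrite ltnS => Kj; have {}IH := IH Kj; rewrite big_nat_recr //=.
  have xr : enorm (x j - xs) < r.
    by apply: lt_le_trans (close j Kj IH) _; rewrite ge_min lexx orbT.
  have := step j (leq_trans KK0 Kj) xr.
  have := ler_enormD (x j.+1 - x j) (x j - xs); rewrite subrKA.
  by lra.
exists K => j Kj; apply: lt_le_trans (close j Kj (bound j Kj)) _.
by rewrite ge_min lexx.
Qed.

End Trapping.

(** * Convergence of the iterates *)

Section Run.
Context {R : realType} {n : nat}.
Variables (f : 'cV[R]_n -> R) (rho sigma alpha Acap s M Bcap beta Zcap zexp : R).
Variables (a b z : nat -> R) (B : nat -> 'M[R]_n) (x : nat -> 'cV[R]_n).
Variable xstar : 'cV[R]_n.
Hypothesis f_diff : forall y, differentiable f y.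
Hypothesis grad_cont : {for xstar, continuous (grad f)}.
Hypothesis rho_range : 0 < rho < 1.
Hypothesis sigma_range : 0 < sigma < 1.
Hypothesis alpha_range : 0 < alpha <= 1.
Hypothesis Acap_gt0 : 0 < Acap.
Hypothesis s_gt0 : 0 < s.
Hypothesis M_gt0 : 0 < M.
Hypothesis Bcap_gt0 : 0 < Bcap.
Hypothesis beta_gt0 : 0 < beta.
Hypothesis Zcap_gt0 : 0 < Zcap.
Hypothesis zexp_range : 0 < zexp <= 1.
Hypothesis a_gt0 : forall k, 0 < a k.
Hypothesis b_gt0 : forall k, 0 < b k.
Hypothesis z_gt0 : forall k, 0 < z k.
Hypothesis B_sym : forall k, (B k)^T = B k.
Hypothesis B_bounded : forall k, spectral_norm (B k) <= M.
Hypothesis never_stationary : forall k, grad f (x k) <> 0.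
Hypothesis run : forall k, iteration f rho sigma alpha Acap s
  (Num.min Bcap (b k * enorm (grad f (x k)) `^ beta)) (a k)
  (Num.min Zcap (z k * enorm (grad f (x k)) `^ zexp)) (B k) (x k) (x k.+1).
Hypothesis a_tails : small_tails (fun k => a k `^ (- alpha^-1)).
Hypothesis b_tails : small_tails (fun k => b k `^ (- beta^-1)).
Hypothesis z_tails : small_tails (fun k => z k `^ (- zexp^-1)).
Hypothesis xstar_acc : accumulation_points x xstar.

Let sigma_gt0 : 0 < sigma. Proof. by case/andP: sigma_range. Qed.

Lemma frequently_close eps K : 0 < eps ->
  exists2 k, (K <= k)%N & enorm (x k - xstar) < eps.
Proof. exact: limn_einf0_frequently. Qed.

Lemma value_decrease k : f (x k.+1) < f (x k).
Proof.
have [d [fl [lam [dir step ->]]]] := run k.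
rewrite -subr_gt0.
apply: (@lt_le_trans _ _ (sigma * lam * - dot (grad f (x k)) d)).
  rewrite !mulr_gt0 ?(step_size_gt0 rho_range s_gt0 step) //.
  by apply: descent_direction dir.
by apply: decrease_slope dir step.
Qed.

Lemma value_mono i j : (i <= j)%N -> f (x j) <= f (x i).
Proof.
elim: j => [|j IH]; first by rewrite leqn0 => /eqP ->.
rewrite leq_eqVlt => /orP[/eqP -> //|]; rewrite ltnS => /IH.
by apply: le_trans; exact/ltW/value_decrease.
Qed.

Lemma value_close eps : 0 < eps -> exists2 r, 0 < r &
  forall w, enorm (w - xstar) < r -> `|f xstar - f w| < eps.
Proof.
have /cvgrPdist_lt fc := differentiable_continuous (f_diff xstar).
by move=> /fc /nbhs_enorm_ball.
Qed.

(** Once a value is at most [f xstar], the next one is strictly smaller, and by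
    monotonicity the values could no longer approach [f xstar]. *)
Lemma value_gt k : 0 < f (x k) - f xstar.
Proof.
rewrite subr_gt0 ltNge; apply/negP => h.
have e0 : 0 < f xstar - f (x k.+1).
  by rewrite subr_gt0; apply: lt_le_trans h; exact: value_decrease.
have [r r0 hr] := value_close e0; have [j kj /hr] := frequently_close k.+1 r0.
have := value_mono kj; rewrite ltr_norml => ? /andP[_]; lra.
Qed.

Lemma value_cvg eps : 0 < eps ->
  exists K, forall k, (K <= k)%N -> f (x k) - f xstar < eps.
Proof.
move=> /value_close[r r0 hr]; have [K _ /hr] := frequently_close 0 r0.
rewrite ltr_norml => /andP[h _]; exists K => k /value_mono; lra.
Qed.

Lemma step_le_decrease : exists2 C, 0 < C & forall k D,
  f (x k) - f (x k.+1) <= enorm (grad f (x k)) * D ->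
  enorm (x k.+1 - x k) <= C *
    (D + (a k `^ (- alpha^-1) + b k `^ (- beta^-1) + z k `^ (- zexp^-1))).
Proof.
exists (step_constant sigma alpha Acap s M Bcap beta Zcap zexp).
  exact: step_constant_gt0.
move=> k D; have [d [fl [lam [dir step ->]]]] := run k.
rewrite [x k + _ - _]addrAC subrr add0r => h.
by apply: step_length_bound dir step _ h.
Qed.

(** The desingularized gap phi(f(x_k) - f_star) plays the part of [Phi] in
    [trapped_converges]: by concavity its decrement is at least the decrease of
    [f] times phi', that is, at least the decrease divided by |g_k|. *)
Lemma KL_convergence : KL_property f xstar ->
  forall eps, 0 < eps -> exists K, forall k, (K <= k)%N -> enorm (x k - xstar) < eps.
Proof.
case=> eta [V [phi [eta0 /nbhs_enorm_ball[r r0 rV] des KL]]].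
have [C C0 stepC] := step_le_decrease.
have [K0 inner] : exists K0, forall k, (K0 <= k)%N ->
    ((f (x k) - f xstar)%:E < eta)%E.
  have [del del0 hdel] := desingularizing_small des eta0 ltr01.
  have [K hK] := value_cvg del0; exists K => k /hK h.
  by have [] := hdel (f (x k) - f xstar); rewrite ?(ltW (value_gt k)).
have phi_ge0 k : (K0 <= k)%N -> 0 <= phi (f (x k) - f xstar).
  move=> Kk; have [_ ph _ _ _] := des; apply: ph.
  by split; [exact/ltW/value_gt|exact: inner].
(* The index is shifted so that [Phi] is nonnegative from the start: [phi] is
   under control only on the interval below [eta]. *)
pose Phi k := phi (f (x (maxn k K0)) - f xstar).
apply: (@trapped_converges _ _ x xstar r C Phi
  (fun k => C * (a k `^ (- alpha^-1) + b k `^ (- beta^-1) + z k `^ (- zexp^-1))) K0) => //.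
- by move=> k; apply: phi_ge0; rewrite leq_maxr.
- move=> eps ep0; have [del del0 hdel] := desingularizing_small des eta0 ep0.
  have [K hK] := value_cvg del0; exists K => k Kk.
  have /hK h : (K <= maxn k K0)%N by rewrite leq_max Kk.
  by have [] := hdel (f (x (maxn k K0)) - f xstar); rewrite ?(ltW (value_gt _)).
- by apply/small_tailsZ/small_tailsD => //; exact: small_tailsD.
- exact: frequently_close.
move=> k Kk near_xstar; rewrite -mulrDr; apply: stepC.
have Kk1 : (K0 <= k.+1)%N by rewrite (leq_trans Kk).
rewrite /Phi (maxn_idPl Kk) (maxn_idPl Kk1).
have gap := desingularizing_gap des (value_gt k) (inner k Kk)
  (v := f (x k.+1) - f xstar).
have {gap} := gap; rewrite (ltW (value_gt _)) ltrD2r value_decrease => /(_ isT).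
have -> : f (x k) - f xstar - (f (x k.+1) - f xstar) = f (x k) - f (x k.+1) by lra.
move=> gap; have := KL _ (rV _ near_xstar) (value_gt k) (inner k Kk).
have dec : 0 <= f (x k) - f (x k.+1) by rewrite subr_ge0; exact/ltW/value_decrease.
move=> /(ler_wpM2l dec); rewrite mulr1 => /le_trans; apply.
rewrite mulrA mulrC ler_wpM2l ?enorm_ge0 //.
by rewrite mulrC.
Qed.

(** Summability makes [w k `^ (- p^-1)] tend to zero, so [threshold_size] excludes
    an unreached threshold when [g] is bounded away from zero. *)
Lemma threshold_reached (w : nat -> R) (c p t : R) :
  small_tails (fun k => w k `^ (- p^-1)) ->
  (forall k, 0 < w k) -> 0 < c -> 0 < p -> 0 < t ->
  exists K, forall k (g : R), (K <= k)%N -> t <= g -> c <= w k * g `^ p.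
Proof.
move=> tails w0 c0 p0 t0.
have [|K hK] := small_tails_terms tails (_ : 0 < t / c `^ p^-1).
  by rewrite divr_gt0 ?powR_gt0.
exists K => k g Kk tg; rewrite leNgt; apply/negP => bad.
have := threshold_size (w0 k) p0 (lt_le_trans t0 tg) bad.
have := hK k Kk; rewrite ltr_pdivlMr ?powR_gt0 // mulrC; lra.
Qed.

(** If the limit gradient has norm gam > 0, then eventually |d_k| and the slope
    per unit length are bounded below. The steps tend to zero, so the
    line search has rejected the trial step mu = lambda / rho, and the mean value
    theorem yields a gradient between x_k and x_k + mu d_k that differs from g_k
    by at least a fixed amount, although both points are close to the limit. *)
Lemma limit_stationary :
  (forall eps, 0 < eps ->
    exists K, forall k, (K <= k)%N -> enorm (x k - xstar) < eps) ->
  grad f xstar = 0.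
Proof.
move=> xcvg; apply: contrapT => /enorm_gt0; set gam := enorm _ => gam0.
pose kap := length_constant Acap M Bcap Zcap.
pose nu := angle_constant Acap M Bcap Zcap.
have kap0 : 0 < kap by exact: length_constant_gt0.
have nu0 : 0 < nu by exact: angle_constant_gt0.
have [rho0 rho1] := andP rho_range; have [_ sigma1] := andP sigma_range.
have g20 : 0 < gam / 2 by rewrite divr_gt0.
pose del := (1 - sigma) * (nu * (gam / 2)).
have del0 : 0 < del by rewrite !mulr_gt0 // subr_gt0.
have [r1 r10 grad_half] := continuous_enorm_ball grad_cont g20.
have del3 : 0 < del / 3 by rewrite divr_gt0.
have [r2 r20 grad_close] := continuous_enorm_ball grad_cont del3.
(* The three bounds on [e1] make, in this order, the step size smaller than
   [s], the mean value point close to [xstar], and the curvature term small. *)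
have [e1 e10 [e1s e1r e1M]] : exists2 e, 0 < e &
    [/\ 2 * e <= s * (kap * (gam / 2)), 3 * e <= rho * r2 &
       sigma * M * e <= rho * (del / 3)].
  exists (Num.min (s * (kap * (gam / 2)) / 2)
    (Num.min (rho * r2 / 3) (rho * (del / 3) / (sigma * M)))).
    by rewrite !lt_min !divr_gt0 ?mulr_gt0 ?subr_gt0.
  split; rewrite mulrC -ler_pdivlMr ?mulr_gt0 // !ge_min lexx ?orbT //.
have [K1 hK1] := xcvg _ e10; have [K2 hK2] := xcvg _ r10.
have alpha0 : 0 < alpha by case/andP: alpha_range.
have [K3 hK3] := threshold_reached a_tails a_gt0 Acap_gt0 alpha0 g20.
have [K4 hK4] := threshold_reached b_tails b_gt0 Bcap_gt0 beta_gt0 g20.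
pose k := maxn (maxn K1 K2) (maxn K3 K4).
have [k1 k2 k3 k4] : [/\ (K1 <= k)%N, (K2 <= k)%N, (K3 <= k)%N & (K4 <= k)%N].
  by rewrite /k !leq_max !leqnn ?orbT.
have g_ge : gam / 2 <= enorm (grad f (x k)).
  have := ler_enormB (grad f xstar) (grad f (x k)); rewrite enormBC -/gam.
  by have := grad_half _ (hK2 k k2); lra.
have [d [fl [lam [dir step xk1]]]] := run k.
have lam0 := step_size_gt0 rho_range s_gt0 step.
have [len ang] : kap * enorm (grad f (x k)) <= enorm d /\
    nu * enorm (grad f (x k)) * enorm d <= - dot (grad f (x k)) d.
  by apply: angle_length dir _ _ => //; [exact: hK3|exact: hK4].
have d_ge : kap * (gam / 2) <= enorm d.
  by apply: le_trans len; rewrite ler_pM2l.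
have d0 : 0 < enorm d by apply: lt_le_trans d_ge; exact: mulr_gt0.
have short : lam * enorm d < 2 * e1.
  rewrite -[lam]gtr0_norm // -enormZ.
  have -> : lam *: d = (x k.+1 - xstar) - (x k - xstar).
    by rewrite xk1 opprB addrA subrK addrAC subrr add0r.
  have := ler_enormD (x k.+1 - xstar) (- (x k - xstar)); rewrite enormN.
  have := hK1 k k1; have := hK1 k.+1 (leqW k1); lra.
have lam_s : lam < s.
  rewrite -(ltr_pM2r d0); apply: lt_le_trans short (le_trans e1s _).
  by rewrite ler_pM2l.
have back : sigma * (lam / rho) * dot (grad f (x k)) d -
    sigma / 2 * (lam / rho) ^+ 2 * (M * enorm d ^+ 2) <
    f (x k + (lam / rho) *: d) - f (x k).
  by apply: step_size_backtracked step lam_s => //; exact: ltW.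
set mu := lam / rho in back.
have mu0 : 0 < mu by exact: divr_gt0.
have mu_short : rho * (mu * enorm d) < 2 * e1.
  by rewrite mulrA [rho * _]mulrC divfK ?gt_eqF.
have [c /andP[c0 cmu] mvt] := line_MVT f_diff (x k) d (ltW mu0).
set xi := x k + c *: d in mvt.
have rho_xk : rho * enorm (x k - xstar) < e1.
  by apply: le_lt_trans (hK1 k k1); rewrite ler_piMl ?enorm_ge0 // ltW.
have xk_close : enorm (x k - xstar) < r2.
  rewrite -(ltr_pM2l rho0); apply: lt_le_trans rho_xk (le_trans _ e1r).
  by rewrite ler_peMl ?(ltW e10) // ler1n.
have xi_close : enorm (xi - xstar) < r2.
  rewrite -(ltr_pM2l rho0); apply: lt_le_trans e1r.
  have : enorm (xi - xstar) <= enorm (x k - xstar) + mu * enorm d.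
    rewrite /xi addrAC; apply: le_trans (ler_enormD _ _) _.
    by rewrite lerD2l enormZ ger0_norm // ler_wpM2r ?enorm_ge0.
  rewrite -(ler_pM2l rho0) mulrDr => /le_lt_trans; apply.
  by apply: lt_le_trans (ltrD rho_xk mu_short) _; rewrite -{1}[e1]mul1r -mulrDl.
have grad_diff : dot (grad f xi - grad f (x k)) d <= 2 * (del / 3) * enorm d.
  apply: le_trans (dot_le_enorm _ _) _; rewrite ler_wpM2r ?enorm_ge0 //.
  have -> : grad f xi - grad f (x k) =
      (grad f xi - grad f xstar) - (grad f (x k) - grad f xstar).
    by rewrite opprB addrA subrK.
  apply: le_trans (ler_enormD _ _) _.
  by rewrite enormN mulr_natl mulr2n lerD // ltW // grad_close.
have slope : del * enorm d <= (1 - sigma) * - dot (grad f (x k)) d.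
  rewrite /del -mulrA ler_pM2l ?subr_gt0 //; apply: le_trans ang.
  by rewrite ler_wpM2r ?enorm_ge0 // ler_pM2l.
have curv : sigma / 2 * M * (mu * enorm d) < del / 3.
  rewrite -(ltr_pM2l rho0); apply: lt_le_trans e1M.
  have : sigma / 2 * M * (rho * (mu * enorm d)) < sigma / 2 * M * (2 * e1).
    by rewrite ltr_pM2l // !mulr_gt0.
  have -> : sigma / 2 * M * (2 * e1) = sigma * M * e1 by field.
  by apply: le_lt_trans; rewrite le_eqVlt; apply/orP; left; apply/eqP; ring.
have : mu * (sigma * dot (grad f (x k)) d - sigma / 2 * M * (mu * enorm d) * enorm d)
    < mu * dot (grad f xi) d.
  rewrite -mvt; apply: le_lt_trans back.
  by rewrite le_eqVlt; apply/orP; left; apply/eqP; ring.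
rewrite ltr_pM2l // => final.
have curvd : sigma / 2 * M * (mu * enorm d) * enorm d < del / 3 * enorm d.
  by rewrite ltr_pM2r.
move: grad_diff slope final curvd; rewrite dotBl; lra.
Qed.

End Run.

Theorem theorem3p10 (R : realType) (n : nat) (f : 'cV[R]_n -> R)
    (rho sigma alpha Acap s : R)
    (theta a zeta : nat -> R) (abar : R)
    (B : nat -> 'M[R]_n) (x : nat -> 'cV[R]_n)
    (M : R)
    (Bcap beta bbar : R) (b : nat -> R)
    (Zcap zexp zbar : R) (z : nat -> R)
    (xstar : 'cV[R]_n)
    (f_C2 : twice_continuously_differentiable f)
    (rho_range : 0 < rho < 1)
    (sigma_range : 0 < sigma < 1)
    (alpha_range : 0 < alpha <= 1)
    (Acap_range : 0 < Acap <= 1)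
    (s_gt0 : 0 < s)
    (theta_ge0 : forall k, 0 <= theta k)
    (abar_gt0 : 0 < abar)
    (a_ge : forall k, abar <= a k)
    (zeta_ge0 : forall k, 0 <= zeta k)
    (B_sym : forall k, (B k)^T = B k)
    (x_generated : generated f rho sigma alpha Acap s theta a zeta B x)
    (M_gt0 : 0 < M)
    (B_bounded : forall k, spectral_norm (B k) <= M)
    (Bcap_gt0 : 0 < Bcap)
    (beta_gt0 : 0 < beta)
    (bbar_gt0 : 0 < bbar)
    (b_ge : forall k, bbar <= b k)
    (thetaE : forall k,
       theta k = Num.min Bcap (b k * enorm (grad f (x k)) `^ beta))
    (Zcap_gt0 : 0 < Zcap)
    (zexp_range : 0 < zexp <= 1)
    (zbar_gt0 : 0 < zbar)
    (z_ge : forall k, zbar <= z k)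
    (zetaE : forall k,
       zeta k = Num.min Zcap (z k * enorm (grad f (x k)) `^ zexp))
    (a_summable : (\sum_(1 <= k <oo) (a k `^ (- alpha^-1))%:E < +oo)%E)
    (z_summable : (\sum_(1 <= k <oo) (z k `^ (- zexp^-1))%:E < +oo)%E)
    (b_summable : (\sum_(1 <= k <oo) (b k `^ (- beta^-1))%:E < +oo)%E)
    (xstar_acc : accumulation_points x xstar)
    (xstar_KL : KL_property f xstar) :
  (exists K, stops_at f x K) \/
  (x @ \oo --> xstar /\ (fun k => enorm (grad f (x k))) @ \oo --> (0 : R)).
Proof.
have [[k gk0]|nostop] := pselect (exists k, grad f (x k) = 0).
  left; pose P k := `[< grad f (x k) = 0 >].
  have exP : exists k, P k by exists k; apply/asboolP.
  case: (ex_minnP exP) => K /asboolP gK Kmin; exists K; split=> // j jK gj.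
  by have := Kmin j; rewrite leqNgt jK => /(_ (introT (asboolP _) gj)).
right.
have never_stationary k : grad f (x k) <> 0 by move=> gk; apply: nostop; exists k.
have a_gt0 k : 0 < a k by exact: lt_le_trans (a_ge k).
have b_gt0 k : 0 < b k by exact: lt_le_trans (b_ge k).
have z_gt0 k : 0 < z k by exact: lt_le_trans (z_ge k).
have run k : iteration f rho sigma alpha Acap s
    (Num.min Bcap (b k * enorm (grad f (x k)) `^ beta)) (a k)
    (Num.min Zcap (z k * enorm (grad f (x k)) `^ zexp)) (B k) (x k) (x k.+1).
  by rewrite -thetaE -zetaE; have [_] := x_generated k; apply.
have [f_diff grad_diff _] := f_C2.
have grad_cont : {for xstar, continuous (grad f)}.
  exact/differentiable_continuous/grad_diff.
have Acap_gt0 : 0 < Acap by case/andP: Acap_range.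
have a_tails := summable_small_tails (fun k => powR_ge0 (a k) _) a_summable.
have b_tails := summable_small_tails (fun k => powR_ge0 (b k) _) b_summable.
have z_tails := summable_small_tails (fun k => powR_ge0 (z k) _) z_summable.
have close := KL_convergence f_diff rho_range sigma_range alpha_range Acap_gt0
  s_gt0 M_gt0 Bcap_gt0 beta_gt0 Zcap_gt0 zexp_range a_gt0 b_gt0 z_gt0 B_sym
  B_bounded never_stationary run a_tails b_tails z_tails xstar_acc xstar_KL.
have gstar : grad f xstar = 0.
  exact: (limit_stationary f_diff grad_cont rho_range sigma_range alpha_range
    Acap_gt0 s_gt0 M_gt0 Bcap_gt0 beta_gt0 Zcap_gt0 a_gt0 b_gt0 z_gt0 B_sym
    B_bounded never_stationary run a_tails b_tails close).
split; first exact: cvg_enormP.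
apply/cvgrPdist_lt => e e0.
have [r r0 hr] := continuous_enorm_ball grad_cont e0.
have [K hK] := close r r0; exists K => // k /= Kk.
have := hr _ (hK k Kk); rewrite gstar subr0 sub0r normrN.
by rewrite ger0_norm ?enorm_ge0.
Qed.
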